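(* The identity problem and the group problem are undecidable for braids in $B_5$. That is: (i) there is no algorithm which, given a finite set $B \subseteq B_5$ of braids, decides whether the trivial braid belongs to $\langle B \rangle$; and (ii) there is no algorithm which, given a finite set $B \subseteq B_5$, decides whether the semigroup $\langle B \rangle$ is a group.
   Context: $B_5$ is the braid group on five strands, with generators $\sigma_1,\dots,\sigma_4$ and relations $\sigma_i\sigma_j = \sigma_j\sigma_i$ for $|i-j|\ge 2$ and $\sigma_i\sigma_{i+1}\sigma_i = \sigma_{i+1}\sigma_i\sigma_{i+1}$ for $1 \le i \le 3$; braids are given as words over the generators and their inverses. For a finite set $B$ of braids, $\langle B \rangle$ is the semigroup of all nonempty finite products of elements of $B$. The trivial braid is the identity element of $B_5$. *)

(* Defs.v *)
(* [boolp] is used only to turn braid equivalence into a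
   boolean relation, so that the library quotient construction applies. *)
From HB Require Import structures.
From mathcomp Require Import all_boot.
From mathcomp Require Import boolp.

Set Implicit Arguments.
Unset Strict Implicit.
Unset Printing Implicit Defensive.

Local Open Scope group_scope.
Local Open Scope quotient_scope.

(* [(i, true)] is sigma_{i+1} and [(i, false)] is its inverse. *)
Definition braid_letter (n : nat) := ('I_n.-1 * bool)%type.
HB.instance Definition _ n := Finite.on (braid_letter n).
Definition braid_word (n : nat) := seq (braid_letter n).

Definition letter_inv n (x : braid_letter n) : braid_letter n := (x.1, ~~ x.2).
Definition word_inv n (u : braid_word n) : braid_word n :=
  rev (map (@letter_inv n) u).

(* The congruence on words whose quotient is the group with Artin's
   presentation: [braid_eq_free] gives inverses, the last two constructors are
   the two families of braid relations. *)
Inductive braid_eq (n : nat) : braid_word n -> braid_word n -> Prop :=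
| braid_eq_refl u : braid_eq u u
| braid_eq_sym u v : braid_eq u v -> braid_eq v u
| braid_eq_trans u v w : braid_eq u v -> braid_eq v w -> braid_eq u w
| braid_eq_cat u u' v v' :
    braid_eq u u' -> braid_eq v v' -> braid_eq (u ++ v) (u' ++ v')
| braid_eq_free x : braid_eq [:: x; letter_inv x] [::]
| braid_eq_far (i j : 'I_n.-1) : (i.+1 < j) || (j.+1 < i) ->
    braid_eq [:: (i, true); (j, true)] [:: (j, true); (i, true)]
| braid_eq_artin (i j : 'I_n.-1) : j = i.+1 :> nat ->
    braid_eq [:: (i, true); (j, true); (i, true)]
             [:: (j, true); (i, true); (j, true)].

Definition braid_eqb n : rel (braid_word n) := fun u v => `[< braid_eq u v >].

Lemma braid_eqb_refl n : reflexive (@braid_eqb n).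
Proof. by move=> u; apply/asboolP; apply: braid_eq_refl. Qed.

Lemma braid_eqb_sym n : symmetric (@braid_eqb n).
Proof. by move=> u v; apply/asboolP/asboolP; apply: braid_eq_sym. Qed.

Lemma braid_eqb_trans n : transitive (@braid_eqb n).
Proof.
by move=> v u w /asboolP uv /asboolP vw; apply/asboolP; apply: braid_eq_trans vw.
Qed.

Canonical braid_equiv n :=
  EquivRel (@braid_eqb n) (@braid_eqb_refl n) (@braid_eqb_sym n)
    (@braid_eqb_trans n).

Definition braid (n : nat) := {eq_quot @braid_equiv n}.
HB.instance Definition _ n := Choice.on (braid n).

Definition braid_of n (w : braid_word n) : braid n := \pi_(braid n) w.

Lemma braid_ofP n (u v : braid_word n) : braid_of u = braid_of v <-> braid_eq u v.
Proof.
by split=> [/eqmodP /asboolP //|uv]; apply/eqmodP/asboolP.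
Qed.

Lemma braid_repr n (u : braid_word n) :
  braid_eq (repr (braid_of u)) u.
Proof. by apply/braid_ofP; rewrite /braid_of reprK. Qed.

Lemma letter_invK n : involutive (@letter_inv n).
Proof. by case=> i b; rewrite /letter_inv /= negbK. Qed.

Lemma word_invK n : involutive (@word_inv n).
Proof.
by move=> u; rewrite /word_inv map_rev revK -map_comp map_id_in // => x _ /=;
   rewrite letter_invK.
Qed.

Lemma word_catV n (u : braid_word n) : braid_eq (u ++ word_inv u) [::].
Proof.
elim: u => [|x u IH]; first exact: braid_eq_refl.
have -> : (x :: u) ++ word_inv (x :: u)
       = [:: x] ++ ((u ++ word_inv u) ++ [:: letter_inv x]).
  by rewrite /word_inv /= rev_cons -cats1 !catA.
apply: braid_eq_trans (braid_eq_free x).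
apply: (@braid_eq_cat _ [:: x] [:: x]); first exact: braid_eq_refl.
by apply: (@braid_eq_cat _ _ [::]) => //; apply: braid_eq_refl.
Qed.

Lemma word_catVl n (u : braid_word n) : braid_eq (word_inv u ++ u) [::].
Proof. by have := word_catV (word_inv u); rewrite word_invK. Qed.

Definition braid_one n : braid n := braid_of [::].
Definition braid_mul n (a b : braid n) : braid n := braid_of (repr a ++ repr b).
Definition braid_inv n (a : braid n) : braid n := braid_of (word_inv (repr a)).

Lemma braid_mulE n (u v : braid_word n) :
  braid_mul (braid_of u) (braid_of v) = braid_of (u ++ v).
Proof. by apply/braid_ofP; apply: braid_eq_cat; apply: braid_repr. Qed.

Lemma braid_of_surj n (a : braid n) : exists u, a = braid_of u.
Proof. by exists (repr a); rewrite /braid_of reprK. Qed.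

Lemma braid_mulA n : associative (@braid_mul n).
Proof.
move=> a b c; have [u ->] := braid_of_surj a; have [v ->] := braid_of_surj b.
by have [w ->] := braid_of_surj c; rewrite !braid_mulE catA.
Qed.

Lemma braid_mul1b n : left_id (braid_one n) (@braid_mul n).
Proof.
by move=> a; have [u ->] := braid_of_surj a; rewrite /braid_one braid_mulE.
Qed.

Lemma braid_mulb1 n : right_id (braid_one n) (@braid_mul n).
Proof.
by move=> a; have [u ->] := braid_of_surj a; rewrite /braid_one braid_mulE cats0.
Qed.

Lemma braid_mulVb n : left_inverse (braid_one n) (@braid_inv n) (@braid_mul n).
Proof.
move=> a; rewrite -[X in braid_mul _ X]reprK -/(braid_of _) braid_mulE.
by apply/braid_ofP; apply: word_catVl.
Qed.

Lemma braid_mulbV n : right_inverse (braid_one n) (@braid_inv n) (@braid_mul n).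
Proof.
move=> a; rewrite -[X in braid_mul X]reprK -/(braid_of _) braid_mulE.
by apply/braid_ofP; apply: word_catV.
Qed.

HB.instance Definition _ n := isGroup.Build (braid n)
  (@braid_mulA n) (@braid_mul1b n) (@braid_mulb1 n) (@braid_mulVb n) (@braid_mulbV n).

Lemma braid_ofM n (u v : braid_word n) :
  braid_of (u ++ v) = braid_of u * braid_of v.
Proof. by rewrite -braid_mulE. Qed.

(* The finite set [B] is presented by a sequence listing its elements. *)
Definition semigroup_gen (G : monoidType) (B : seq G) (x : G) : Prop :=
  exists s : seq G, [/\ s != [::], {subset s <= B} & x = \prod_(y <- s) y].

(* The neutral element [e] is not required to be that of the ambient monoid. *)
Definition is_group (G : monoidType) (S : G -> Prop) : Prop :=
  (forall x y, S x -> S y -> S (x * y)) /\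
  exists2 e, S e &
    forall x, S x -> (e * x = x /\ x * e = x) /\
      exists2 y, S y & x * y = e /\ y * x = e.

(* Algorithms are register machines over words (Shepherdson-Sturgis): each of
   the registers 0, 1, 2, ... holds a word over the finite alphabet [A], and a
   program is a finite list of instructions addressed by position.
   - [Push r a]: put [a] in front of register [r], go to the next instruction;
   - [Pop r k]: if register [r] is empty jump to [k None]; otherwise remove its
     first letter [a] and jump to [k (Some a)];
   - [Halt b]: stop with answer [b].
   A jump outside the program blocks, and no answer is returned. *)
Inductive instruction (A : Type) :=
| Push of nat & A
| Pop of nat & (option A -> nat)
| Halt of bool.

Definition program (A : Type) := seq (instruction A).
Definition registers (A : Type) := nat -> seq A.

Definition set_reg A (R : registers A) (r : nat) (w : seq A) : registers A :=
  fun i => if i == r then w else R i.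

Inductive returns A (M : program A) : nat -> registers A -> bool -> Prop :=
| returns_halt pc R b :
    onth M pc = Some (Halt A b) -> returns M pc R b
| returns_push pc R b r a :
    onth M pc = Some (Push r a) ->
    returns M pc.+1 (set_reg R r (a :: R r)) b -> returns M pc R b
| returns_pop_empty pc R b r k :
    onth M pc = Some (Pop r k) -> R r = [::] ->
    returns M (k None) R b -> returns M pc R b
| returns_pop pc R b r k a w :
    onth M pc = Some (Pop r k) -> R r = a :: w ->
    returns M (k (Some a)) (set_reg R r w) b -> returns M pc R b.

Definition initial_registers A (w : seq A) : registers A :=
  fun i => if i is 0 then w else [::].

(* A program decides [P] if on every instance it halts with the right answer;
   instances are supplied through their encoding as words over [A]. *)
Definition decides (A : finType) (I : Type) (enc : I -> seq A)
    (M : program A) (P : I -> Prop) : Prop :=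
  forall i, exists2 b, returns M 0 (initial_registers (enc i)) b & b <-> P i.

Definition undecidable (A : finType) (I : Type) (enc : I -> seq A)
    (P : I -> Prop) : Prop :=
  ~ exists M : program A, decides enc M P.

(* A finite set of braids is given by a list of words, written out over the
   letters sigma_i^{+-1} and an end-of-word marker [None]. *)
Definition encode_words n (L : seq (braid_word n)) : seq (option (braid_letter n)) :=
  flatten [seq rcons (map Some w) None | w <- L].

Definition identity_problem n (L : seq (braid_word n)) : Prop :=
  semigroup_gen (map (@braid_of n) L) 1.

Definition group_problem n (L : seq (braid_word n)) : Prop :=
  is_group (semigroup_gen (map (@braid_of n) L)).

(* Main.v *)
(* [B_5] contains a product of two free groups: the strands 1, 2, 3 carry one of
   them (in [sigma_1], [sigma_2]), while the strands 4, 5 together with the first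
   three strands taken as one carry the other.  Freeness is seen by forgetting all
   strands but three and playing ping-pong in the plane with the image in
   [SL_2(Z)].

   For a presentation with relators [z] and a word [w], take the pairs
   [Fwd r = (u, r)], [Bwd r = (s^-1 v^-1 s, r^-1)] for the rules [r = (u, v)], where
   [u], [v] are [c] and [c z] in either order, together with [Top = ($ w s, 1)] and
   [Bot = (s^-1 $^-1, 1)].  A derivation of [w = 1] from the relators gives a product
   [Bot * Fwd r_1 * ... * Fwd r_n * Top * Bwd r_n * ... * Bwd r_1 = 1], as in the
   usual reduction to Post's problem; it can be prolonged so as to use all pairs.
   Conversely map everything to a group in which the relators hold.  The second
   components show that a trivial product stays trivial when the factors [Top] are
   erased, so some product of conjugates of [w] is trivial, and there is at least
   one factor [Top] since products of the [Fwd r] and [Bwd r] alone map to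
   nonnegative matrices.

   The presentation attached to a program has commuting letters [x_i], whose
   exponents are the codes of the registers, a letter [t_p] for each position [p],
   a letter for each instruction, which conjugates the translates of [t_p] by
   configurations as the instruction prescribes, and a letter [k] commuting with
   the instructions and with the accepting [t_p].  The word [w] is the commutator
   of [k] with the translate of [t_0] by the initial configuration (an
   Aanderaa-Cohen type construction).  If the program does not accept, then [w] is
   nontrivial in an explicit permutation group, where it acts as a central
   translation of the Heisenberg group on one fibre; so no product of conjugates
   of [w] is trivial. *)
From Stdlib Require Import ZArith Lia.
From HB Require Import structures.
From mathcomp Require Import all_boot.
From mathcomp Require Import boolp zify.
Require Import Defs.

Set Implicit Arguments.
Unset Strict Implicit.
Unset Printing Implicit Defensive.

Local Open Scope group_scope.

#[local] Arguments Z.add : simpl never.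
#[local] Arguments Z.sub : simpl never.
#[local] Arguments Z.mul : simpl never.
#[local] Arguments Z.of_nat : simpl never.

(** * Marking strands of a braid *)

Definition marking := (bool * bool * bool * bool * bool)%type.

Definition marked (S : marking) : nat :=
  let: (a, b, c, d, e) := S in a + b + c + d + e.

Definition swap_marks (i : nat) (S : marking) : marking :=
  let: (a, b, c, d, e) := S in
  match i with
  | 0 => (b, a, c, d, e)
  | 1 => (a, c, b, d, e)
  | 2 => (a, b, d, c, e)
  | _ => (a, b, c, e, d)
  end.

(** [Some k] means that both crossing strands are marked and that, once the unmarked strands are
    forgotten, the crossing is generator number [k] of the remaining braid group. *)
Definition crossing (i : nat) (S : marking) : option nat :=
  let: (a, b, c, d, e) := S in
  match i with
  | 0 => if a && b then Some 0 else None
  | 1 => if b && c then Some (a : nat) else None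
  | 2 => if c && d then Some (a + b) else None
  | _ => if d && e then Some (a + b + c) else None
  end.

(** The images in [SL_2(Z)] of the two generators of [B_3] and of their inverses. *)
Definition shear (k : nat) (e : bool) (v : Z * Z) : Z * Z :=
  match k, e with
  | 0, true => (v.1, v.2 + v.1)%Z
  | 0, false => (v.1, v.2 - v.1)%Z
  | _, true => (v.1 - v.2, v.2)%Z
  | _, false => (v.1 + v.2, v.2)%Z
  end.

Definition strand_step (st : marking * (Z * Z)) (x : braid_letter 5) :=
  (swap_marks x.1 st.1,
   if crossing x.1 st.1 is Some k then shear k x.2 st.2 else st.2).

Definition strand_run (u : braid_word 5) st := foldl strand_step st u.

Lemma strand_run_cat u v st :
  strand_run (u ++ v) st = strand_run v (strand_run u st).
Proof. exact: foldl_cat. Qed.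

Lemma marked_swap i S : marked (swap_marks i S) = marked S.
Proof. by case: S => [[[[a b] c] d] e]; case: i => [|[|[|i]]] /=; lia. Qed.

Lemma marked_run u st : marked (strand_run u st).1 = marked st.1.
Proof. by elim: u st => //= x u IH st; rewrite IH marked_swap. Qed.

Lemma strand_stepK x st : strand_step (strand_step st x) (letter_inv x) = st.
Proof.
case: st x => [[[[[a b] c] d] e] [x y]] [[i hi] s]; rewrite /strand_step /=.
by case: i {hi} => [|[|[|i]]]; case: a b c d e => [] [] [] [] [];
  case: s => //=; congr (_, (_, _)); lia.
Qed.

(* With exactly three marked strands only two generators of [B_3] occur, and
   [shear 0], [shear 1] satisfy their braid relation. *)
Lemma strand_run_braid_eq u v : braid_eq u v ->
  forall st, marked st.1 = 3 -> strand_run u st = strand_run v st.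
Proof.
elim=> {u v}.
- by [].
- by move=> u v _ IH st h; rewrite IH.
- by move=> u v w _ IH1 _ IH2 st h; rewrite IH1 ?IH2.
- move=> u u' v v' _ IH1 _ IH2 st h; rewrite !strand_run_cat IH1 //.
  by rewrite IH2 ?marked_run.
- by move=> x st _; rewrite /= strand_stepK.
- move=> [i hi] [j hj] /= h [[[[[a b] c] d] e] [x y]].
  move: i j h hi hj => [|[|[|[|i]]]] [|[|[|[|j]]]] // _ hi hj;
  by case: a b c d e => [] [] [] [] [].
- move=> [i hi] [j hj] /= h [[[[[a b] c] d] e] [x y]].
  move: i j h hi hj => [|[|[|[|i]]]] [|[|[|[|j]]]] // _ hi hj;
  case: a b c d e => [] [] [] [] [] //= _; rewrite /strand_run /strand_step /=;
  congr (_, (_, _)); lia.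
Qed.

(** * Two commuting families of pure braids *)

Definition sig (i : nat) (e : bool) : braid_letter 5 := (inord i, e).

(** If [a] and [b] are free generators, the conjugates of [b] by powers of [a] are free of infinite
    rank, so the exponent can code a letter of a countable alphabet. *)
Definition conj_letter (a b : braid_word 5) (x : nat * bool) : braid_word 5 :=
  flatten (nseq x.1 a) ++ (if x.2 then b else word_inv b)
  ++ flatten (nseq x.1 (word_inv a)).

(* The pure braid in which the fourth strand winds once around the first three. *)
Definition winding : braid_word 5 :=
  [seq sig i true | i <- [:: 2; 1; 0; 0; 1; 2]%N].

(** Pure braids preserve the markings. The factors 2 and 4 they produce in the plane are large
    enough for ping-pong. *)
Definition left_letter :=
  conj_letter [:: sig 0 true; sig 0 true] (nseq 4 (sig 1 true)).
Definition right_letter := conj_letter winding (nseq 4 (sig 3 true)).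

Definition left_word (u : seq (nat * bool)) := flatten (map left_letter u).
Definition right_word (u : seq (nat * bool)) := flatten (map right_letter u).

Definition plane_step (v : Z * Z) (x : nat * bool) : Z * Z :=
  let n := (2 * Z.of_nat x.1)%Z in
  let y := (v.2 + n * v.1)%Z in
  let x' := (if x.2 then v.1 - 4 * y else v.1 + 4 * y)%Z in
  (x', y - n * x')%Z.

Definition left_marks : marking := (true, true, true, false, false).
(** Only one of the first three strands is kept, so [winding] becomes a full twist of the first two
    kept strands and [right_letter] looks like [left_letter] under [left_marks]. *)
Definition right_marks : marking := (true, false, false, true, true).

Lemma inordK4 i : (i < 4)%N -> (inord i : 'I_4) = i :> nat.
Proof. exact: inordK. Qed.

Lemma strand_run_nseq u S (f : Z * Z -> Z * Z) n v :
  (forall v, strand_run u (S, v) = (S, f v)) ->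
  strand_run (flatten (nseq n u)) (S, v) = (S, iter n f v).
Proof. by move=> h; elim: n v => //= n IH v; rewrite strand_run_cat h IH -iterSr. Qed.

Lemma conj_letter_run a b S x v :
  (forall v, strand_run a (S, v) = (S, (v.1, v.2 + 2 * v.1)%Z)) ->
  (forall v, strand_run (word_inv a) (S, v) = (S, (v.1, v.2 - 2 * v.1)%Z)) ->
  (forall v, strand_run b (S, v) = (S, (v.1 - 4 * v.2, v.2)%Z)) ->
  (forall v, strand_run (word_inv b) (S, v) = (S, (v.1 + 4 * v.2, v.2)%Z)) ->
  strand_run (conj_letter a b x) (S, v) = (S, plane_step v x).
Proof.
move=> ha ha' hb hb'; rewrite /conj_letter !strand_run_cat.
rewrite (strand_run_nseq _ _ ha) //.
have ia n w : iter n (fun v : Z * Z => (v.1, v.2 + 2 * v.1)%Z) w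
              = (w.1, w.2 + 2 * Z.of_nat n * w.1)%Z.
  elim: n => [|n IH]; first by case: w => ? ? /=; congr (_, _); lia.
  by rewrite iterS IH Nat2Z.inj_succ /=; congr (_, _); lia.
have ia' n w : iter n (fun v : Z * Z => (v.1, v.2 - 2 * v.1)%Z) w
              = (w.1, w.2 - 2 * Z.of_nat n * w.1)%Z.
  elim: n => [|n IH]; first by case: w => ? ? /=; congr (_, _); lia.
  by rewrite iterS IH Nat2Z.inj_succ /=; congr (_, _); lia.
by case: x => n [] /=; rewrite ?hb ?hb' (strand_run_nseq _ _ ha') !ia !ia'.
Qed.

Ltac run_braid :=
  move=> [? ?]; rewrite /strand_run /strand_step /=;
  rewrite ?inordK4 //=; congr (_, (_, _)); lia.

Lemma left_letter_left x v :
  strand_run (left_letter x) (left_marks, v) = (left_marks, plane_step v x).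
Proof. by apply: conj_letter_run; run_braid. Qed.

Lemma right_letter_right x v :
  strand_run (right_letter x) (right_marks, v) = (right_marks, plane_step v x).
Proof. by apply: conj_letter_run; run_braid. Qed.

Lemma conj_letter_still a b S x v :
  (forall v, strand_run a (S, v) = (S, v)) ->
  (forall v, strand_run (word_inv a) (S, v) = (S, v)) ->
  (forall v, strand_run b (S, v) = (S, v)) ->
  (forall v, strand_run (word_inv b) (S, v) = (S, v)) ->
  strand_run (conj_letter a b x) (S, v) = (S, v).
Proof.
move=> ha ha' hb hb'; rewrite /conj_letter !strand_run_cat.
have st n w : iter n id w = w :> Z * Z by elim: n => //= n ->.
rewrite (@strand_run_nseq a S id) // st.
by case: x => n [] /=; rewrite ?hb ?hb' (@strand_run_nseq _ S id) // st.
Qed.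

Ltac run_still :=
  move=> [? ?]; rewrite /strand_run /strand_step /=; by rewrite ?inordK4.

Lemma left_letter_right x v :
  strand_run (left_letter x) (right_marks, v) = (right_marks, v).
Proof. by apply: conj_letter_still; run_still. Qed.

Lemma right_letter_left x v :
  strand_run (right_letter x) (left_marks, v) = (left_marks, v).
Proof. by apply: conj_letter_still; run_still. Qed.

(** Each marking sees only one factor: the letters of the other never cross two marked strands. *)
Lemma braid_of_left_right_plane u v :
  braid_of (left_word u ++ right_word v) = 1 ->
  (forall w, foldl plane_step w u = w) /\ (forall w, foldl plane_step w v = w).
Proof.
move=> /braid_ofP uv.
have run S w : marked S = 3 ->
    strand_run (left_word u ++ right_word v) (S, w) = (S, w).
  by move=> hS; rewrite (strand_run_braid_eq uv).
have fl (f : nat * bool -> _) S (g : Z * Z -> nat * bool -> Z * Z) t w :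
    (forall x w, strand_run (f x) (S, w) = (S, g w x)) ->
    strand_run (flatten (map f t)) (S, w) = (S, foldl g w t).
  by move=> h; elim: t w => //= x t IH w; rewrite strand_run_cat h IH.
have id_fold t w : foldl (fun w _ => w) w t = w :> Z * Z.
  by move: w; elim: t.
split=> w.
- have := run left_marks w erefl; rewrite strand_run_cat.
  rewrite (fl _ _ _ _ _ left_letter_left).
  rewrite (fl _ _ (fun w _ => w) _ _ right_letter_left) id_fold.
  by case.
- have := run right_marks w erefl; rewrite strand_run_cat.
  rewrite (fl _ _ (fun w _ => w) _ _ left_letter_right) id_fold.
  rewrite (fl _ _ _ _ _ right_letter_right).
  by case.
Qed.

Lemma braid_ofV n (u : braid_word n) : braid_of (word_inv u) = (braid_of u)^-1.
Proof.
apply/esym/mulg1_eq; rewrite -braid_ofM; apply/braid_ofP; exact: word_catV.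
Qed.

Lemma braid_of_nseq n k (u : braid_word n) :
  braid_of (flatten (nseq k u)) = braid_of u ^+ k.
Proof. by elim: k => //= k IH; rewrite braid_ofM IH expgS. Qed.

Lemma conj_letterE a b n e : braid_of (conj_letter a b (n, e)) =
  braid_of a ^+ n * (if e then braid_of b else (braid_of b)^-1) / braid_of a ^+ n.
Proof.
rewrite /conj_letter !braid_ofM !braid_of_nseq braid_ofV expVgn mulgA /=.
by case: e; rewrite ?braid_ofV.
Qed.

Lemma conj_letterV a b n e :
  braid_of (conj_letter a b (n, ~~ e)) = (braid_of (conj_letter a b (n, e)))^-1.
Proof. by rewrite !conj_letterE; case: e; rewrite /= !invgM ?invgK mulgA. Qed.

Definition sgen i : braid 5 := braid_of [:: sig i true].

Lemma sgen_far i j : (i < 4)%N -> (j < 4)%N -> (i.+1 < j)%N ->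
  sgen i * sgen j = sgen j * sgen i.
Proof.
move=> hi hj ij; rewrite /sgen -!braid_ofM; apply/braid_ofP; apply: braid_eq_far.
by rewrite !inordK4 // ij.
Qed.

Lemma sgen_artin i : (i.+1 < 4)%N ->
  sgen i * sgen i.+1 * sgen i = sgen i.+1 * sgen i * sgen i.+1.
Proof.
move=> hi; rewrite /sgen -!braid_ofM; apply/braid_ofP.
apply: (@braid_eq_artin 5 (inord i) (inord i.+1)).
by rewrite !inordK4 // ltnW.
Qed.

(** For [x], [y], [z] the first three generators, [z * y * x * x * y * z] is [winding], which
    commutes with every braid of the first three strands. *)
Lemma braid_relation_commute (G : groupType) (x y z : G) :
  x * z = z * x -> x * y * x = y * x * y -> y * z * y = z * y * z ->
  commute x (z * y * x * x * y * z) /\ commute y (z * y * x * x * y * z).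
Proof.
move=> xz xyx yzy; rewrite /commute; split.
- transitivity (z * (x * y * x) * x * y * z); first by rewrite !mulgA xz.
  rewrite xyx; transitivity (z * y * x * (x * y * x) * z).
    by rewrite xyx !mulgA.
  by rewrite -!mulgA xz.
- transitivity ((y * z * y) * x * x * y * z); first by rewrite !mulgA.
  rewrite yzy; transitivity (z * y * (z * x) * x * y * z).
    by rewrite !mulgA.
  rewrite -xz; transitivity (z * y * x * (z * x) * y * z).
    by rewrite !mulgA.
  rewrite -xz; transitivity (z * y * x * x * (z * y * z)).
    by rewrite !mulgA.
  by rewrite -yzy !mulgA.
Qed.

Lemma left_right_commute u v :
  commute (braid_of (left_word u)) (braid_of (right_word v)).
Proof.
have [w0 w1] : commute (sgen 0) (braid_of winding) /\
               commute (sgen 1) (braid_of winding).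
  have -> : braid_of winding =
    sgen 2 * sgen 1 * sgen 0 * sgen 0 * sgen 1 * sgen 2 by rewrite /sgen -!braid_ofM.
  apply: braid_relation_commute; first exact: sgen_far.
    exact: (@sgen_artin 0).
  exact: (@sgen_artin 1).
have c03 : commute (sgen 0) (sgen 3) by apply: sgen_far.
have c13 : commute (sgen 1) (sgen 3) by apply: sgen_far.
have flat (f : nat * bool -> braid_word 5) x :
    (forall a, commute x (braid_of (f a))) ->
    forall t, commute x (braid_of (flatten (map f t))).
  move=> h; elim=> [|a t IH]; first exact: commute1.
  by rewrite /= braid_ofM; apply: commuteM.
have nseqX i k : braid_of (nseq k (sig i true)) = sgen i ^+ k.
  by rewrite -braid_of_nseq; congr braid_of; elim: k => //= k ->.
have conj (a b : braid_word 5) x c : commute x (braid_of a) ->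
    commute x (braid_of b) -> commute x (braid_of (conj_letter a b c)).
  case: c => n e ca cb; rewrite conj_letterE.
  apply: commuteM; last by apply: commuteV; apply: commuteX.
  apply: commuteM; first exact: commuteX.
  by case: e => //; apply: commuteV.
apply: (flat _ _) => b; apply: commute_sym; apply: (flat _ _) => a; apply: commute_sym.
have e0 : braid_of [:: sig 0 true; sig 0 true] = sgen 0 ^+ 2 := nseqX 0 2.
apply: (conj _ _ _); apply: commute_sym; apply: (conj _ _ _);
  rewrite ?e0 ?nseqX.
- by apply: commuteX; apply: commute_sym.
- by apply: commuteX; apply: commute_sym.
- by apply: commuteX2; apply: commute_sym.
- by apply: commuteX2; apply: commute_sym.
Qed.

(** * Two commuting free subgroups *)

Definition is_action (T Xi : Type) (act : T * bool -> Xi -> Xi) :=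
  forall x b, cancel (act (x, b)) (act (x, ~~ b)).

Definition run_action (T Xi : Type) (act : T * bool -> Xi -> Xi) xi u :=
  foldl (fun xi x => act x xi) xi u.

(* Equality to 1 in the free group on [T], expressed by its universal property. *)
Definition trivial_word (T : Type) (u : seq (T * bool)) :=
  forall (Xi : Type) (act : T * bool -> Xi -> Xi),
    is_action act -> forall xi, run_action act xi u = xi.

Lemma run_action_cat T Xi (act : T * bool -> Xi -> Xi) xi u v :
  run_action act xi (u ++ v) = run_action act (run_action act xi u) v.
Proof. exact: foldl_cat. Qed.

(** In the coordinates [(v.1, y)], which undo the conjugating shear, this is a pair of opposite
    cones [2|y| <= |v.1|], [y <> 0]. The letter fixes [y] and moves [v.1] by [4|y|], so whatever
    lies outside the cones of its inverse and has [y <> 0] lands in its own. *)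
Definition region (x : nat * bool) (v : Z * Z) : Prop :=
  let y := (v.2 + 2 * Z.of_nat x.1 * v.1)%Z in
  if x.2 then (0 < y /\ v.1 <= - 2 * y \/ y < 0 /\ - 2 * y <= v.1)%Z
  else (0 < y /\ 2 * y <= v.1 \/ y < 0 /\ v.1 <= 2 * y)%Z.

Lemma plane_step_region x v :
  let y := (v.2 + 2 * Z.of_nat x.1 * v.1)%Z in
  y <> 0%Z -> ~ region (x.1, ~~ x.2) v -> region x (plane_step v x).
Proof.
case: x v => n e [a b]; rewrite /region /plane_step /=.
move: (2 * Z.of_nat n)%Z => m.
have -> (c : Z) : (b + m * a - m * c + m * c = b + m * a)%Z by lia.
by case: e => /=; lia.
Qed.

Lemma region_disjoint x y v : region x v -> y != (x.1, ~~ x.2) ->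
  (v.2 + 2 * Z.of_nat y.1 * v.1)%Z <> 0%Z /\ ~ region (y.1, ~~ y.2) v.
Proof.
case: x y v => n e [m f] [a b] hx yx.
have [nm|nm] := eqVneq n m.
  rewrite -nm /= in yx *; split.
    by move: hx; rewrite /region /=; case: e {yx}; lia.
  move: yx hx; rewrite xpair_eqE eqxx /= => /eqP fe.
  rewrite /region /=; case: e f fe => [] [] //= _; lia.
(* For distinct exponents the change of coordinates adds a term of size at least [2|a|] to a
   coordinate of size at most [|a|/2]; the result is nonzero and too large for either pair of
   cones. *)
have big : (1 <= Z.abs (Z.of_nat m - Z.of_nat n))%Z by move/eqP: nm; lia.
have far : (Z.abs a <= Z.abs ((Z.of_nat m - Z.of_nat n) * a))%Z.
  by rewrite Z.abs_mul; nia.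
have key : (b + 2 * Z.of_nat m * a =
    b + 2 * Z.of_nat n * a + 2 * ((Z.of_nat m - Z.of_nat n) * a))%Z by lia.
move: hx; rewrite /region /= key.
move: (b + 2 * Z.of_nat n * a)%Z ((Z.of_nat m - Z.of_nat n) * a)%Z far => c d far.
by case: e {yx} => hx; (split; first lia); case: f => /=; lia.
Qed.

Lemma plane_step_is_action : is_action (fun x v => plane_step v x).
Proof.
move=> n e [a b]; rewrite /plane_step /=; move: (2 * Z.of_nat n)%Z => m.
by case: e => /=; congr (_, _); lia.
Qed.

Definition reduced (u : seq (nat * bool)) :=
  sorted (fun x y => y != (x.1, ~~ x.2)) u.

Lemma reduced_run u x : reduced (rcons u x) ->
  region x (foldl plane_step (0, 1)%Z (rcons u x)).
Proof.
elim/last_ind: u x => [|u y IH] x hu.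
  rewrite /=; apply: plane_step_region => /=; first lia.
  by rewrite /region /=; case: x.2 => /=; lia.
have [hy hx] : reduced (rcons u y) /\ x != (y.1, ~~ y.2).
  move: hu; rewrite /reduced; case: u {IH} => [|z u] /=; first by rewrite andbT.
  by rewrite !rcons_path last_rcons => /andP[? ?].
rewrite -cats1 foldl_cat /=; have [h1 h2] := region_disjoint (IH _ hy) hx.
exact: plane_step_region.
Qed.

Lemma unsorted_split (T : Type) (r : rel T) (u : seq T) : ~~ sorted r u ->
  exists u1 x y u2, u = u1 ++ x :: y :: u2 /\ ~~ r x y.
Proof.
elim: u => //= x [|y u] IH //=; rewrite negb_and => /orP[h|/IH].
  by exists [::], x, y, u.
by move=> [u1] [z] [t] [u2] [-> h]; exists (x :: u1), z, t, u2.
Qed.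

(** A nonempty reduced word moves [(0, 1)] into a cone, and [(0, 1)] lies in none. Any other word
    loses a cancelling pair, and induction on the length applies. *)
Lemma plane_trivial_word u :
  (forall w, foldl plane_step w u = w) -> trivial_word u.
Proof.
have [k] := ubnP (size u); elim: k u => // k IH u /ltnSE uk hu Xi act hact xi.
have [red|/unsorted_split] := boolP (reduced u).
  case/lastP: u uk hu red => [//|u x] uk hu red.
  have := reduced_run red; rewrite hu /region /=; case: x.2; lia.
move=> [u1] [[n b]] [y] [u2] [def_u /negPn/eqP /= yx].
rewrite def_u run_action_cat /= yx hact.
rewrite -run_action_cat; apply: IH => //.
  by move: uk; rewrite def_u !size_cat /=; lia.
move=> w; rewrite -[RHS]hu def_u !foldl_cat /= yx.
by rewrite plane_step_is_action.
Qed.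

Definition code_letter (T : countType) (x : T * bool) : nat * bool :=
  (pickle x.1, x.2).

(** An action of [T] extends to all codes: those that decode to nothing act trivially. *)
Lemma trivial_word_code (T : countType) (u : seq (T * bool)) :
  trivial_word (map (@code_letter T) u) -> trivial_word u.
Proof.
move=> hu Xi act hact xi.
pose act' (x : nat * bool) :=
  if unpickle x.1 is Some t then act (t, x.2) else id.
rewrite -[RHS](hu _ act') => [|n b x]; last first.
  by rewrite /act' /=; case: (unpickle n) => //= t; rewrite hact.
elim: u {hu} xi => //= [[x b] u] IH xi.
by rewrite /= {2}/act' /= pickleK IH.
Qed.

(** * Products with trivial image in both free groups *)

Section Instance.

Variables (G : countType) (gens : seq G) (rels : seq (seq (G * bool))).

(* [None] is a letter standing for the neutral element: it lets every rule have
   nonempty sides. *)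
Definition pletter := option (G * bool).
Definition rule := (pletter * seq (G * bool) * bool)%type.

(** Words equal to 1 in the presented group. The empty one yields the rules that copy a letter. *)
Definition fillers : seq (seq (G * bool)) :=
  [::] :: [seq [:: (g, b); (g, ~~ b)] | g <- gens, b <- [:: true; false]] ++ rels.

Definition pletters : seq pletter :=
  None :: [seq Some (g, b) | g <- gens, b <- [:: true; false]].

Definition rules : seq rule :=
  [seq (cz, d) | cz <- [seq (c, z) | c <- pletters, z <- fillers],
                 d <- [:: true; false]].

Definition long_side (r : rule) : seq pletter := r.1.1 :: map some r.1.2.
Definition upper (r : rule) := if r.2 then long_side r else [:: r.1.1].
Definition lower (r : rule) := if r.2 then [:: r.1.1] else long_side r.

Inductive token := Fwd of rule | Bwd of rule | Top of seq (G * bool) | Bot.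

Definition inv_word (T : Type) (u : seq (T * bool)) : seq (T * bool) :=
  rev [seq (x.1, ~~ x.2) | x <- u].

Definition pos_word (w : seq pletter) : seq (option pletter * bool) :=
  [seq (some c, true) | c <- w].

Definition switch (e : bool) : option pletter * bool := (None, e).

(* The extra generator [None] of the first component separates the forward
   phase from the backward phase. *)
Definition first_word (t : token) : seq (option pletter * bool) :=
  match t with
  | Fwd r => pos_word (upper r)
  | Bwd r => switch false :: rcons (inv_word (pos_word (lower r))) (switch true)
  | Top w => rcons (pos_word (None :: map some w)) (switch true)
  | Bot => switch false :: inv_word (pos_word [:: None])
  end.

Definition second_word (t : token) : seq (rule * bool) :=
  match t with Fwd r => [:: (r, true)] | Bwd r => [:: (r, false)] | _ => [::] end.

Definition token_word (t : token) : braid_word 5 :=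
  left_word (map (@code_letter _) (first_word t)) ++
  right_word (map (@code_letter _) (second_word t)).

Definition fixed_words : seq (braid_word 5) :=
  [seq token_word (Fwd r) | r <- rules] ++
  ([seq token_word (Bwd r) | r <- rules] ++ [:: token_word Bot]).

Definition all_words (w : seq (G * bool)) : seq (braid_word 5) :=
  rcons fixed_words (token_word (Top w)).

Lemma run_action_inv T Xi (act : T * bool -> Xi -> Xi) u xi :
  is_action act -> run_action act (run_action act xi u) (inv_word u) = xi.
Proof.
move=> hact; elim: u xi => //= [[x b] u] IH xi.
by rewrite /inv_word /= rev_cons -cats1 run_action_cat IH /= hact.
Qed.

Lemma inv_wordK (T : Type) : involutive (@inv_word T).
Proof.
move=> u; rewrite /inv_word map_rev revK -map_comp -[RHS]map_id.
by apply: eq_map => -[x b] /=; rewrite negbK.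
Qed.

Definition legal (w : seq (G * bool)) (t : token) : bool :=
  match t with
  | Fwd r => r \in rules
  | Bwd r => r \in rules
  | Top v => v == w
  | Bot => true
  end.

Lemma all_words_tokens w s :
  {subset s <= map (@braid_of 5) (all_words w)} ->
  exists2 ts, s = map (@braid_of 5 \o token_word) ts & all (legal w) ts.
Proof.
elim: s => [|x s IH] hs; first by exists [::].
have [|ts -> hts] := IH; first by move=> y ys; apply: hs; rewrite inE ys orbT.
suff [t -> ht] : exists2 t, x = braid_of (token_word t) & legal w t.
  by exists (t :: ts); rewrite //= ht.
have /mapP[u + ->] := hs x (mem_head _ _).
rewrite /all_words mem_rcons inE => /orP[/eqP ->|].
  by exists (Top w) => /=.
rewrite /fixed_words mem_cat => /orP[h|].
  by have [r rr ->] := mapP h; exists (Fwd r).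
rewrite mem_cat => /orP[h|].
  by have [r rr ->] := mapP h; exists (Bwd r).
by rewrite inE => /eqP ->; exists Bot.
Qed.

Definition left_of (T : countType) (u : seq (T * bool)) : braid 5 :=
  braid_of (left_word (map (@code_letter _) u)).
Definition right_of (T : countType) (u : seq (T * bool)) : braid 5 :=
  braid_of (right_word (map (@code_letter _) u)).

Lemma left_of_cat (T : countType) (u v : seq (T * bool)) :
  left_of (u ++ v) = left_of u * left_of v.
Proof. by rewrite /left_of /left_word !map_cat flatten_cat braid_ofM. Qed.

Lemma right_of_cat (T : countType) (u v : seq (T * bool)) :
  right_of (u ++ v) = right_of u * right_of v.
Proof. by rewrite /right_of /right_word !map_cat flatten_cat braid_ofM. Qed.

Lemma left_of_inv (T : countType) (u : seq (T * bool)) :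
  left_of (inv_word u) = (left_of u)^-1.
Proof.
elim: u => [|[x b] u IH]; first by rewrite /left_of /= -[LHS]/(1 : braid 5) invg1.
rewrite /inv_word /= rev_cons -cats1 left_of_cat [left_of (rev _)]IH.
rewrite -[(x, b) :: u]cat1s left_of_cat invgM; congr (_ * _).
by rewrite /left_of /left_word /= !cats0; apply: conj_letterV.
Qed.

Lemma right_of_inv (T : countType) (u : seq (T * bool)) :
  right_of (inv_word u) = (right_of u)^-1.
Proof.
elim: u => [|[x b] u IH]; first by rewrite /right_of /= -[LHS]/(1 : braid 5) invg1.
rewrite /inv_word /= rev_cons -cats1 right_of_cat [right_of (rev _)]IH.
rewrite -[(x, b) :: u]cat1s right_of_cat invgM; congr (_ * _).
by rewrite /right_of /right_word /= !cats0; apply: conj_letterV.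
Qed.

Lemma prod_tokens ts : \prod_(t <- ts) braid_of (token_word t) =
  left_of (flatten (map first_word ts)) * right_of (flatten (map second_word ts)).
Proof.
elim: ts => [|t ts IH]; first by rewrite big_nil -[RHS]/(1 * 1 : braid 5) mulg1.
rewrite big_cons IH /= left_of_cat right_of_cat /token_word braid_ofM.
rewrite -/(left_of _) -/(right_of _) -!mulgA; congr (_ * _); rewrite !mulgA.
by congr (_ * _); apply: commute_sym; apply: left_right_commute.
Qed.

Lemma identity_tokens w :
  semigroup_gen (map (@braid_of 5) (all_words w)) 1 ->
  exists ts : seq token, [/\ ts <> [::], all (legal w) ts,
    trivial_word (flatten (map first_word ts)) &
    trivial_word (flatten (map second_word ts))].
Proof.
move=> [s [s0 /all_words_tokens [ts def_s hts] prod1]]; exists ts.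
have ts0 : ts <> [::] by move=> ts0; rewrite def_s ts0 in s0.
have : left_of (flatten (map first_word ts)) *
    right_of (flatten (map second_word ts)) = 1.
  by rewrite -prod_tokens [RHS]prod1 def_s big_map.
rewrite /left_of /right_of -braid_ofM.
by case/braid_of_left_right_plane => h1 h2;
  split=> //; apply: trivial_word_code; apply: plane_trivial_word.
Qed.

Section Soundness.

Variables (Xi : Type) (act : G * bool -> Xi -> Xi).

Definition pact (x : option pletter * bool) (xi : Xi) : Xi :=
  if x.1 is Some (Some (g, b)) then act (g, b == x.2) xi else xi.

(** A rule acts as either of its sides, which agree because fillers act trivially. *)
Definition ract (x : rule * bool) (xi : Xi) : Xi :=
  run_action pact xi
    (if x.2 then pos_word (upper x.1) else inv_word (pos_word (upper x.1))).

Hypothesis act_action : is_action act.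

Lemma pact_action : is_action pact.
Proof.
move=> [[[g c]|]|] b xi //; rewrite /pact /=.
by case: b c => [] [] /=; rewrite ?(act_action g true) ?(act_action g false).
Qed.

Lemma ract_action : is_action ract.
Proof.
move=> r [] xi; rewrite /ract /=; first exact/run_action_inv/pact_action.
rewrite -{2}[pos_word _]inv_wordK; exact/run_action_inv/pact_action.
Qed.

Lemma run_pact_some xi (z : seq (G * bool)) :
  run_action pact xi (pos_word (map some z)) = run_action act xi z.
Proof.
elim: z xi => //= [[g b] z] IH xi.
by rewrite {2}/pact /= eqb_id IH.
Qed.

Hypothesis act_rels :
  forall z, z \in rels -> forall xi, run_action act xi z = xi.

Lemma act_fillers z xi : z \in fillers -> run_action act xi z = xi.
Proof.
rewrite inE => /predU1P[-> //|]; rewrite mem_cat => /orP[|/act_rels ->//].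
by case/allpairsPdep => g [b] [_ _ ->] /=; rewrite act_action.
Qed.

Lemma rulesP r : r \in rules -> (r.1.1 \in pletters) && (r.1.2 \in fillers).
Proof.
case/allpairsPdep => cz [d] [/allpairsPdep [c [z [hc hz ->]]] _ ->] /=.
by rewrite hc.
Qed.

Lemma run_upper_lower r xi : r \in rules ->
  run_action pact xi (pos_word (upper r)) = run_action pact xi (pos_word (lower r)).
Proof.
case/rulesP/andP => _ hz; rewrite /upper /lower.
have e y : run_action pact y (pos_word (long_side r))
           = run_action pact y (pos_word [:: r.1.1]).
  by rewrite /= run_pact_some act_fillers.
by case: r.2; rewrite e.
Qed.

Variable (shift : Xi -> Xi).
Hypothesis act_shift : forall x xi, act x (shift xi) = shift (act x xi).
Hypothesis shift_free : forall n xi, iter n.+1 shift xi <> xi.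

Lemma pact_shift u xi : run_action pact (shift xi) u = shift (run_action pact xi u).
Proof.
elim: u xi => //= x u IH xi; rewrite -IH; congr (run_action _ _ u).
by rewrite /pact; case: x.1 => [[[g b]|]|].
Qed.

Lemma ract_shift n u xi :
  run_action ract (iter n shift xi) u = iter n shift (run_action ract xi u).
Proof.
have one xi' : run_action ract (shift xi') u = shift (run_action ract xi' u).
  by elim: u xi' => //= x u IH xi'; rewrite {2}/ract pact_shift IH.
by elim: n => //= n <-; rewrite one.
Qed.

Variable (w : seq (G * bool)).
Hypothesis w_shift :
  forall xi, run_action act xi w = xi \/ run_action act xi w = shift xi.

Lemma run_top xi v : run_action pact xi (first_word (Top v)) = run_action act xi v.
Proof.
rewrite /first_word -cats1 run_action_cat /= -run_pact_some; congr run_action.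
Qed.

(** The first component of [Fwd], [Bwd] and [Bot] acts exactly as the second does through [ract]; a
    [Top] adds at most one [shift]. These commute with everything and gather into one power. *)
Lemma run_tokens ts xi : all (legal w) ts -> exists n,
  run_action pact xi (flatten (map first_word ts)) =
  iter n shift (run_action ract xi (flatten (map second_word ts))).
Proof.
elim: ts xi => [|t ts IH] xi /=; first by exists 0.
move=> /andP[ht hts]; rewrite !run_action_cat.
have [n] := IH (run_action pact xi (first_word t)) hts; move=> ->.
suff [m ->] : exists m, run_action pact xi (first_word t) =
    iter m shift (run_action ract xi (second_word t)).
  by exists (n + m)%N; rewrite ract_shift iterD.
case: t ht => [r _|r hr|v /eqP ->|_]; [exists 0|exists 0| |exists 0] => //.
  rewrite /first_word -cat1s -cats1 !run_action_cat /=.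
  have runK u y : run_action pact (run_action pact y (inv_word u)) u = y.
    by rewrite -[X in run_action pact _ X]inv_wordK run_action_inv //; exact: pact_action.
  have inj y z : run_action pact y (pos_word (upper r)) =
      run_action pact z (pos_word (upper r)) -> y = z.
    by move/(congr1 (run_action pact ^~ (inv_word (pos_word (upper r)))));
      rewrite !run_action_inv; first done; exact: pact_action.
  by apply: inj; rewrite run_upper_lower // runK runK.
by rewrite run_top; case: (w_shift xi) => ->; [exists 0%N | exists 1%N].
Qed.

Lemma no_identity_with_top ts v ts' xi0 : run_action act xi0 w = shift xi0 ->
  all (legal w) (ts ++ Top v :: ts') ->
  trivial_word (flatten (map first_word (ts ++ Top v :: ts'))) ->
  trivial_word (flatten (map second_word (ts ++ Top v :: ts'))) -> False.
Proof.
move=> w0; rewrite all_cat /= => /and3P[h /eqP vw h'] t1 t2.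
set u := flatten (map first_word ts).
(* Starting here, the chosen [Top] is met at [xi0], where it does shift, so the total displacement
   is positive. *)
pose xi := run_action pact xi0 (inv_word u).
have xiE : run_action pact xi u = xi0.
  by rewrite -[X in run_action pact _ X]inv_wordK run_action_inv //; exact: pact_action.
have [m hm] := run_tokens xi h; have [n hn] := run_tokens xi0 h'.
have := t1 _ _ pact_action xi; have := t2 _ _ ract_action xi.
have cut T (f : token -> seq T) : flatten (map f (ts ++ Top v :: ts')) =
    flatten (map f ts) ++ f (Top v) ++ flatten (map f ts').
  by rewrite map_cat flatten_cat.
rewrite !cut -/u !run_action_cat run_top vw xiE w0 pact_shift hn.
rewrite -[in iter n _ _]xiE hm ract_shift /= => -> e.
by apply: (@shift_free (n + m) xi); rewrite iterS iterD.
Qed.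

End Soundness.

(** * Products without [Top] *)

Definition is_top (t : token) := if t is Top _ then true else false.

Definition is_bot (t : token) := if t is Bot then true else false.

(** The exponent sum of the switch: 0 on [Fwd] and [Bwd], -1 on [Bot]. A trivial product without
    [Top] therefore has no [Bot]. *)
Definition count_switch (x : option pletter * bool) (n : Z) : Z :=
  if x.1 is Some _ then n else if x.2 then (n + 1)%Z else (n - 1)%Z.

Lemma count_switch_action : is_action count_switch.
Proof. by move=> [c|] [] n; rewrite /count_switch /=; lia. Qed.

Lemma count_pos_word n u : run_action count_switch n (pos_word u) = n.
Proof. by elim: u. Qed.

Lemma count_neg_word n u : run_action count_switch n (inv_word (pos_word u)) = n.
Proof.
by rewrite -{1}(count_pos_word n u) run_action_inv //; apply: count_switch_action.
Qed.

Lemma count_tokens ts n : ~~ has is_top ts ->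
  run_action count_switch n (flatten (map first_word ts)) =
  (n - Z.of_nat (count is_bot ts))%Z.
Proof.
elim: ts n => [|t ts IH] n /=; first by lia.
rewrite negb_or => /andP[ht hts]; rewrite run_action_cat IH //.
case: t ht => [r|r|v|] //= _; first by rewrite count_pos_word.
  by rewrite -cats1 run_action_cat count_neg_word /= /count_switch /=; lia.
by rewrite /count_switch /=; lia.
Qed.

(** Ordinary letters act by a unipotent matrix and the switch by a quarter turn. Conjugation by the
    turn makes the inverse letters inside [Bwd] act by the transposed matrix, again with nonnegative
    entries. *)
Definition positive_plane (x : option pletter * bool) (v : Z * Z) : Z * Z :=
  match x with
  | (Some _, true) => (v.1 + v.2, v.2)%Z
  | (Some _, false) => (v.1 - v.2, v.2)%Z
  | (None, true) => (- v.2, v.1)%Z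
  | (None, false) => (v.2, - v.1)%Z
  end.

Lemma positive_plane_action : is_action positive_plane.
Proof. by move=> [c|] [] [a b]; rewrite /positive_plane /=; congr (_, _); lia. Qed.

Lemma plane_pos_word a b u : run_action positive_plane (a, b) (pos_word u) =
  (a + Z.of_nat (size u) * b, b)%Z.
Proof.
elim: u a => [|c u IH] a; first by congr (_, _); rewrite /=; lia.
by rewrite [LHS]/= IH /= Nat2Z.inj_succ; congr (_, _); lia.
Qed.

Lemma plane_neg_word a b u :
  run_action positive_plane (a, b) (inv_word (pos_word u)) =
  (a - Z.of_nat (size u) * b, b)%Z.
Proof.
have <- : run_action positive_plane (a - Z.of_nat (size u) * b, b)%Z (pos_word u)
          = (a, b) by rewrite plane_pos_word; congr (_, _); lia.
by rewrite run_action_inv //; apply: positive_plane_action.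
Qed.

(** [Fwd] sends [(a, b)] to [(a + k b, b)] and [Bwd] sends it to [(a, b + k a)], where [k] is the
    length of a side of the rule. Sides are nonempty, so each token increases the sum of the
    coordinates. *)
Lemma plane_tokens ts a b : (0 < a)%Z -> (0 < b)%Z -> ts <> [::] ->
  ~~ has is_top ts -> ~~ has is_bot ts ->
  let v := run_action positive_plane (a, b) (flatten (map first_word ts)) in
  (a + b < v.1 + v.2)%Z.
Proof.
move=> a0 b0 ts0 h h'; suff : forall a b, (0 < a)%Z -> (0 < b)%Z ->
  let v := run_action positive_plane (a, b) (flatten (map first_word ts)) in
  (a + b + Z.of_nat (size ts) <= v.1 + v.2)%Z.
  by move=> /(_ _ _ a0 b0); case: ts ts0 {h h'} => // t ts _; cbn zeta;
    rewrite [size _]/= Nat2Z.inj_succ; lia.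
have up r : (1 <= Z.of_nat (size (upper r)))%Z.
  by rewrite /upper; case: r.2 => /=; lia.
have lo r : (1 <= Z.of_nat (size (lower r)))%Z.
  by rewrite /lower; case: r.2 => /=; lia.
elim: ts h h' {a b a0 b0 ts0} => [|t ts IH] /=; first by move=> _ _ a b; lia.
rewrite !negb_or => /andP[ht hts] /andP[hb hbs] a b a0 b0; rewrite run_action_cat.
suff [a' [b' [-> a1 b1 ab]]] : exists a' b',
  [/\ run_action positive_plane (a, b) (first_word t) = (a', b'),
      (0 < a')%Z, (0 < b')%Z & (a + b + 1 <= a' + b')%Z].
  by have := IH hts hbs _ _ a1 b1; cbn zeta; lia.
case: t ht hb => // r _ _.
  rewrite /first_word plane_pos_word; do 2!eexists; split; first by [].
  - by have := up r; nia.
  - by [].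
  - by have := up r; nia.
rewrite /first_word -cat1s -cats1 !run_action_cat /= plane_neg_word /=.
do 2!eexists; split; first by [].
- by lia.
- by have := lo r; nia.
- by have := lo r; nia.
Qed.

Lemma has_top ts : has is_top ts ->
  exists ts1 v ts2, ts = ts1 ++ Top v :: ts2.
Proof.
elim: ts => //= t ts IH; case: t => [r|r|v|] /=; try by
  move=> /IH [ts1 [v [ts2 ->]]]; eexists (_ :: ts1), v, ts2.
by exists [::], v, ts.
Qed.

(* Erasing the letters [Top] from a product with trivial second component does
   not change its action, while each of them moves points up. *)
Theorem identity_not_above w :
  (exists (Xi : Type) (act : G * bool -> Xi -> Xi) (shift : Xi -> Xi),
    [/\ is_action act,
        forall z, z \in rels -> forall xi, run_action act xi z = xi,
        forall x xi, act x (shift xi) = shift (act x xi),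
        forall n xi, iter n.+1 shift xi <> xi &
        (forall xi, run_action act xi w = xi \/ run_action act xi w = shift xi)
        /\ exists xi, run_action act xi w = shift xi]) ->
  ~ semigroup_gen (map (@braid_of 5) (all_words w)) 1.
Proof.
move=> [Xi] [act] [shift] [h1 h2 h3 h4 [h5 [xi0 h6]]].
move/identity_tokens => [ts [ts0 hts t1 t2]].
have [/has_top [ts1 [v [ts2 def_ts]]]|nt] := boolP (has is_top ts).
  move: hts t1 t2; rewrite def_ts.
  exact: (no_identity_with_top h1 h2 h3 h4 h5 h6).
have nb : ~~ has is_bot ts.
  have := t1 _ _ count_switch_action 0%Z; rewrite count_tokens // has_count; lia.
have := @plane_tokens ts 1 1 _ _ ts0 nt nb; cbn zeta.
by rewrite t1 => [/(_ erefl erefl)//|]; apply: positive_plane_action.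
Qed.

(** * From a presentation to a full trivial product *)

Inductive rel_eq : seq (G * bool) -> seq (G * bool) -> Prop :=
| rel_eq_refl u : rel_eq u u
| rel_eq_sym u v : rel_eq u v -> rel_eq v u
| rel_eq_trans u v t : rel_eq u v -> rel_eq v t -> rel_eq u t
| rel_eq_free u v g b : rel_eq (u ++ [:: (g, b); (g, ~~ b)] ++ v) (u ++ v)
| rel_eq_rel u v z : z \in rels -> rel_eq (u ++ z ++ v) (u ++ v).

(* Both sides are arranged so that concatenating sequences of rules telescopes. *)
Definition derives (J : seq rule) (a b : seq pletter) : Prop :=
  {subset J <= rules} /\
  flatten (map upper J) ++ b = a ++ flatten (map lower J).

Lemma derives_nil a : derives [::] a a.
Proof. by split=> //; rewrite cats0. Qed.

Lemma derives_cat J K a b c : derives J a b -> derives K b c -> derives (J ++ K) a c.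
Proof.
move=> [hJ eJ] [hK eK]; split=> [r|].
  by rewrite mem_cat => /orP[/hJ|/hK].
by rewrite !map_cat !flatten_cat -catA eK catA eJ catA.
Qed.

Lemma mem_bools b : b \in [:: true; false].
Proof. by case: b. Qed.

Lemma mem_rules c z d : c \in pletters -> z \in fillers -> (c, z, d) \in rules.
Proof.
move=> hc hz; apply/allpairsPdep; exists (c, z), d; split=> //.
  by apply/allpairsPdep; exists c, z.
by case: d.
Qed.

(** The letters around the rewritten spot are copied by rules with empty filler. *)
Lemma derives_step c z d y1 y2 : c \in pletters -> z \in fillers ->
  {subset y1 <= pletters} -> {subset y2 <= pletters} ->
  exists2 J, (c, z, d) \in J &
    derives J (y1 ++ upper (c, z, d) ++ y2) (y1 ++ lower (c, z, d) ++ y2).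
Proof.
move=> hc hz h1 h2; pose copy (a : pletter) : rule := (a, [::], true).
have cu y : flatten (map upper (map copy y)) = y by elim: y => //= a y ->.
have cl y : flatten (map lower (map copy y)) = y by elim: y => //= a y ->.
exists (map copy y1 ++ (c, z, d) :: map copy y2).
  by rewrite mem_cat mem_head orbT.
split=> [r|].
  rewrite mem_cat inE => /or3P[/mapP[a /h1 ha ->]|/eqP ->|/mapP[a /h2 ha ->]];
  exact: mem_rules.
rewrite !map_cat !flatten_cat /= cu cl [map _ (map copy y2)]/= -!catA.
by rewrite [flatten (map upper (map copy y2))]cu [flatten (map lower (map copy y2))]cl.
Qed.

(** An equality may pass through letters outside [gens]; erasing them keeps it valid, as the
    relators only use [gens]. *)
Definition keep (u : seq (G * bool)) := [seq x <- u | x.1 \in gens].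

Lemma keep_pletters u : {subset None :: map some (keep u) <= pletters}.
Proof.
move=> c; rewrite inE => /predU1P[->|/mapP[[g b]]]; first exact: mem_head.
rewrite mem_filter /= => /andP[hg _] ->; rewrite inE; apply/allpairsPdep.
by exists g, b; split=> //; apply: mem_bools.
Qed.

Hypothesis rels_gens : forall z, z \in rels -> all (fun x => x.1 \in gens) z.

(** A rule inserts or deletes a filler behind some letter; the leading [None] provides one even when
    [keep u] is empty. *)
Lemma derives_filler u z v : z \in fillers ->
  (exists J, derives J (None :: map some (keep u ++ z ++ keep v))
                       (None :: map some (keep u ++ keep v))) /\
  (exists J, derives J (None :: map some (keep u ++ keep v))
                       (None :: map some (keep u ++ z ++ keep v))).
Proof.
move=> hz; have split_last y : exists y1 c,
    None :: map some (keep y) = rcons y1 c.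
  by rewrite lastI; do 2!eexists.
have [y1 [c def_u]] := split_last u.
have hy : {subset rcons y1 c <= pletters} by rewrite -def_u; apply: keep_pletters.
have hc : c \in pletters by apply: hy; rewrite mem_rcons mem_head.
have h1 : {subset y1 <= pletters}.
  by move=> x hx; apply: hy; rewrite mem_rcons inE hx orbT.
have h2 : {subset map some (keep v) <= pletters}.
  by move=> x hx; have := @keep_pletters v x; rewrite inE hx orbT; apply.
have step d := derives_step d hc hz h1 h2.
rewrite !map_cat -!cat_cons def_u -!cats1 -!catA.
split; [have [J _ hJ] := step true|have [J _ hJ] := step false]; exists J;
  by move: hJ; rewrite /upper /lower /long_side /= -?catA.
Qed.

Lemma derives_rel_eq u v : rel_eq u v ->
  (exists J, derives J (None :: map some (keep u)) (None :: map some (keep v))) /\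
  (exists J, derives J (None :: map some (keep v)) (None :: map some (keep u))).
Proof.
elim=> {u v} [u|u v _ [h1 h2]|u v t _ [[J1 hJ1] [K1 hK1]] _ [[J2 hJ2] [K2 hK2]]
             |u v g b|u v z hz].
- by split; exists [::]; apply: derives_nil.
- by split.
- split; first by exists (J1 ++ J2); apply: derives_cat hJ1 hJ2.
  by exists (K2 ++ K1); apply: derives_cat hK2 hK1.
- rewrite /keep !filter_cat /=; have [hg|_] := boolP (g \in gens); last first.
    by split; exists [::]; apply: derives_nil.
  apply: derives_filler; rewrite inE mem_cat; apply/orP; right; apply/orP; left.
  by apply/allpairsPdep; exists g, b; split=> //; apply: mem_bools.
- rewrite /keep !filter_cat (all_filterP (rels_gens hz)).
  by apply: derives_filler; rewrite inE mem_cat hz !orbT.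
Qed.

(** The rule is applied and undone. Such loops let the final product contain every pair, as the
    group problem requires. *)
Lemma derives_loop c z d : c \in pletters -> z \in fillers ->
  exists2 J, (c, z, d) \in J & derives J [:: None] [:: None].
Proof.
move=> hc hz.
have sub0 : {subset ([::] : seq pletter) <= pletters} by [].
have loop y1 y2 : {subset y1 <= pletters} -> {subset y2 <= pletters} ->
    exists2 J, (c, z, d) \in J & derives J (y1 ++ c :: y2) (y1 ++ c :: y2).
  move=> h1 h2; have [J mJ hJ] := derives_step d hc hz h1 h2.
  have [K _ hK] := derives_step (~~ d) hc hz h1 h2.
  case: d mJ hJ K hK => mJ hJ K hK; [exists (K ++ J)|exists (J ++ K)];
    rewrite ?mem_cat ?mJ ?orbT //; exact: derives_cat hK hJ || exact: derives_cat hJ hK.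
move: (hc); rewrite inE => /predU1P[e|/allpairsPdep[g [b [hg _ e]]]].
  by have := loop [::] [::] sub0 sub0; rewrite /= e.
have hn : None \in pletters by apply: mem_head.
have hf : [:: (g, b); (g, ~~ b)] \in fillers.
  rewrite inE mem_cat; apply/orP; right; apply/orP; left.
  by apply/allpairsPdep; exists g, b; split=> //; apply: mem_bools.
(* The letter [c] is created behind [None] together with its inverse; the pair is removed after the
   loop. *)
have [J _ hJ] := derives_step false hn hf sub0 sub0.
have [K _ hK] := derives_step true hn hf sub0 sub0.
have [L mL hL] : exists2 J, (c, z, d) \in J & derives J
    [:: None; Some (g, b); Some (g, ~~ b)] [:: None; Some (g, b); Some (g, ~~ b)].
  rewrite -e; apply: (loop [:: None] [:: Some (g, ~~ b)]) => x; rewrite inE => /eqP -> //.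
  by rewrite inE; apply/allpairsPdep; exists g, (~~ b); split=> //; apply: mem_bools.
exists (J ++ L ++ K); first by rewrite !mem_cat mL orbT.
exact: derives_cat hJ (derives_cat hL hK).
Qed.

Lemma derives_all_rules : exists2 J, {subset rules <= J} & derives J [:: None] [:: None].
Proof.
suff h : forall R : seq rule, {subset R <= rules} ->
    exists2 J, {subset R <= J} & derives J [:: None] [:: None].
  exact: h.
elim=> [|[[c z] d] R IH] hR; first by exists [::] => //; apply: derives_nil.
have [|J hJ dJ] := IH; first by move=> x xR; apply: hR; rewrite inE xR orbT.
have /rulesP/andP[hc hz] := hR _ (mem_head _ _).
have [K hK dK] := derives_loop d hc hz.
exists (K ++ J); last exact: derives_cat dK dJ.
by move=> x; rewrite inE mem_cat => /predU1P[->|/hJ ->]; rewrite ?hK ?orbT.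
Qed.

(** * The trivial product *)

Definition witness (J : seq rule) w : seq token :=
  Bot :: map Fwd J ++ Top w :: rev (map Bwd J).

(** Second components cancel in reverse order. In the first, [derives] says that the upper sides
    followed by the word of [Top] spell [None] followed by the lower sides; [Bot] and the [Bwd]
    tokens remove these, and the switches cancel. *)
Lemma prod_witness J w : derives J [:: None] (None :: map some w) ->
  \prod_(t <- witness J w) braid_of (token_word t) = 1.
Proof.
move=> [_ eJ]; rewrite prod_tokens.
have -> : flatten (map second_word (witness J w)) =
    [seq (r, true) | r <- J] ++ inv_word [seq (r, true) | r <- J].
  rewrite /witness /= map_cat flatten_cat /= -!map_comp /inv_word map_rev.
  rewrite -!map_comp /=; congr (_ ++ _).
    by elim: J {eJ} => //= r J ->.
  elim: J {eJ} => //= r J IH; rewrite !rev_cons -!cats1 flatten_cat IH.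
  by [].
rewrite right_of_cat right_of_inv mulgV mulg1.
set s := left_of [:: switch true].
have sV : left_of [:: switch false] = s^-1 by rewrite -left_of_inv.
pose P c := left_of (pos_word c).
have Pcat c d : P (c ++ d) = P c * P d by rewrite /P /pos_word map_cat left_of_cat.
have e1 : left_of (flatten (map first_word (map Fwd J))) = P (flatten (map upper J)).
  elim: J {eJ} => //= r J IH.
  by rewrite left_of_cat IH Pcat.
have e2 : left_of (flatten (map first_word (rev (map Bwd J)))) =
    s^-1 * (P (flatten (map lower J)))^-1 * s.
  elim: J {eJ e1} => [|r J IH] /=.
    by rewrite -[P _]/(1 : braid 5) -[LHS]/(1 : braid 5) invg1 mulg1 mulVg.
  rewrite rev_cons -cats1 map_cat flatten_cat left_of_cat IH Pcat /= cats0.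
  rewrite -[switch false :: _]cat1s -cats1 !left_of_cat sV left_of_inv -/s -/(P _).
  by rewrite invgM !mulgA mulgK.
have -> : flatten (map first_word (witness J w)) =
    first_word Bot ++ flatten (map first_word (map Fwd J)) ++
    first_word (Top w) ++ flatten (map first_word (rev (map Bwd J))).
  by rewrite /witness /= map_cat flatten_cat.
rewrite !left_of_cat e1 e2 /first_word -cats1 left_of_cat -/s -/(P _).
rewrite -[switch false :: _]cat1s left_of_cat sV left_of_inv -/(P _).
have UW : P (flatten (map upper J)) * P (None :: map some w) =
    P [:: None] * P (flatten (map lower J)) by rewrite -!Pcat eJ.
transitivity (s^-1 / P [:: None] *
    (P (flatten (map upper J)) * P (None :: map some w)) /
    P (flatten (map lower J)) * s); first by rewrite !mulgA mulgK.
by rewrite UW !mulgA mulgVK mulgK mulVg.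
Qed.

Lemma semigroup_genM (H : monoidType) (B : seq H) x y :
  semigroup_gen B x -> semigroup_gen B y -> semigroup_gen B (x * y).
Proof.
move=> [s [s0 hs ->]] [t [t0 ht ->]]; exists (s ++ t); split.
- by case: s s0 {hs}.
- by move=> z; rewrite mem_cat => /orP[/hs|/ht].
- by rewrite big_cat.
Qed.

(** A rotation of a trivial product is trivial, so the factors after [y] followed by those before it
    multiply to [y^-1]. *)
Lemma group_of_full_product (H : groupType) (B s : seq H) :
  s != [::] -> {subset s <= B} -> {subset B <= s} -> \prod_(y <- s) y = 1 ->
  semigroup_gen B 1 /\ is_group (semigroup_gen B).
Proof.
move=> s0 sB Bs s1; have g1 : semigroup_gen B 1 by exists s.
have inv y : y \in B -> semigroup_gen B y^-1.
  move=> /Bs ys; case/splitPr def_s: _ / ys => [p q].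
  (* Appending [s], whose product is 1, keeps the list nonempty even when [y] is the only factor. *)
  have yV : y^-1 = \prod_(z <- q ++ p ++ s) z.
    rewrite !big_cat /= s1 mulg1; apply/mulg1_eq.
    move: s1; rewrite def_s big_cat big_cons /= => pyq.
    have qp : y * \prod_(z <- q) z = (\prod_(z <- p) z)^-1.
      by apply/esym/mulg1_eq.
    by rewrite mulgA qp mulVg.
  exists (q ++ p ++ s); split=> //; first by case: q {def_s yV} => //; case: p.
  move=> z; rewrite !mem_cat => /or3P[zq|zp|/sB //]; apply: sB.
    by rewrite def_s mem_cat inE zq !orbT.
  by rewrite def_s mem_cat zp.
split=> //; split; first exact: semigroup_genM.
exists 1 => // x Bx; split; first by rewrite mul1g mulg1.
exists x^-1; last by rewrite mulgV mulVg.
move: Bx => [t [_ tB ->]] {x}; elim: t tB => [|y t IH] tB; first by rewrite big_nil invg1.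
rewrite big_cons invgM; apply: semigroup_genM.
  by apply: IH => z zt; apply: tB; rewrite inE zt orbT.
exact/inv/tB/mem_head.
Qed.

(** The neutral element is idempotent, hence equal to 1 in the ambient group. *)
Lemma identity_of_group (H : groupType) (B : seq H) :
  is_group (semigroup_gen B) -> semigroup_gen B 1.
Proof.
move=> [_ [e Be he]]; have [[ee _] _] := he _ Be.
by have <- : e = 1 by apply: (mulgI e); rewrite ee mulg1.
Qed.

Lemma legal_word w t : legal w t -> token_word t \in all_words w.
Proof.
rewrite /all_words mem_rcons inE /fixed_words !mem_cat.
case: t => [r hr|r hr|v /eqP ->|_]; rewrite ?eqxx //.
- by rewrite (map_f (token_word \o Fwd)) ?orbT.
- by rewrite (map_f (token_word \o Bwd)) ?orbT.
- by rewrite ?inE ?eqxx ?orbT.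
Qed.

Lemma legal_words w ts : all (legal w) ts ->
  {subset map token_word ts <= all_words w}.
Proof.
elim: ts => // t ts IH /andP[ht hts] u; rewrite map_cons inE => /predU1P[->|].
  exact: legal_word.
exact: IH.
Qed.

(** Loops through all rules come first, then a derivation of [w]; the witness thus contains every
    element of the set. *)
Theorem identity_of_rel_eq w : all (fun x => x.1 \in gens) w -> rel_eq w [::] ->
  semigroup_gen (map (@braid_of 5) (all_words w)) 1 /\
  is_group (semigroup_gen (map (@braid_of 5) (all_words w))).
Proof.
move=> hw /derives_rel_eq [_ [K hK]]; rewrite /keep (all_filterP hw) in hK.
have [J hJ dJ] := derives_all_rules; have dJK := derives_cat dJ hK.
pose ts := witness (J ++ K) w.
pose F t := braid_of (token_word t).
have FE : [seq F t | t <- ts] = F Bot :: map (F \o Fwd) (J ++ K) ++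
    F (Top w) :: rev (map (F \o Bwd) (J ++ K)).
  by rewrite /ts /witness /= map_cat /= map_rev -!map_comp.
apply: (@group_of_full_product _ _ ([seq F t | t <- ts])).
- by rewrite FE.
- have legal_ts : all (legal w) ts.
    rewrite /ts /witness /= all_cat /= all_rev !all_map eqxx /= andbb.
    by apply/allP => r; apply: (proj1 dJK).
  move=> x; rewrite /F map_comp => /mapP[u hu ->].
  apply: map_f; exact: legal_words legal_ts _ hu.
- have JK r : r \in rules -> r \in J ++ K by move=> /hJ; rewrite mem_cat => ->.
  move=> x /mapP[u + ->] {x}; rewrite FE /all_words mem_rcons inE => /orP[/eqP ->|].
    by rewrite inE mem_cat mem_head !orbT.
  rewrite /fixed_words mem_cat => /orP[h|].
    have [r /JK hr ->] := mapP h; rewrite inE mem_cat.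
    by rewrite (map_f (F \o Fwd) hr) orbT.
  rewrite mem_cat => /orP[h|].
    have [r /JK hr ->] := mapP h; rewrite inE mem_cat inE mem_rev.
    by rewrite (map_f (F \o Bwd) hr) !orbT.
  by rewrite inE => /eqP ->; rewrite mem_head.
- by rewrite big_map; apply: prod_witness.
Qed.

End Instance.

(** * A presentation encoding a program, and a model of it *)

(** [Cnt i] is [x_i], [Pt p] is [t_p], [Kap] is [k], and [Sub] gives the instruction letters. The
    flag singles out the loading letters, on which no commutation with [Kap] is imposed. *)
Inductive gen := Cnt of nat | Pt of nat | Sub of bool & nat & nat & nat & nat | Kap.

Definition gen_code (g : gen) : (nat + nat) + (bool * nat * nat * nat * nat + unit) :=
  match g with
  | Cnt i => inl (inl i)
  | Pt p => inl (inr p)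
  | Sub f r a p q => inr (inl (f, r, a, p, q))
  | Kap => inr (inr tt)
  end.

Definition gen_decode (x : (nat + nat) + (bool * nat * nat * nat * nat + unit)) : gen :=
  match x with
  | inl (inl i) => Cnt i
  | inl (inr p) => Pt p
  | inr (inl (f, r, a, p, q)) => Sub f r a p q
  | inr (inr _) => Kap
  end.

Lemma gen_codeK : cancel gen_code gen_decode. Proof. by case. Qed.

HB.instance Definition _ := Countable.copy gen (can_type gen_codeK).

Definition counters := nat -> Z.

Definition upd (s : counters) (r : nat) (v : Z) : counters :=
  fun i => if i == r then v else s i.

#[local] Arguments upd : simpl never.

Lemma upd_same s r v : upd s r v r = v.
Proof. by rewrite /upd eqxx. Qed.

Lemma upd_upd s r v v' : upd (upd s r v) r v' = upd s r v'.
Proof. by apply: funext => i; rewrite /upd; case: eqP. Qed.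

Lemma upd_id s r : upd s r (s r) = s.
Proof. by apply: funext => i; rewrite /upd; case: eqP => [->|]. Qed.

Lemma upd_swap s r r' v v' : r != r' ->
  upd (upd s r v) r' v' = upd (upd s r' v') r v.
Proof.
by move=> /eqP rr; apply: funext => i; rewrite /upd; do 2!case: eqP => //; congruence.
Qed.

Section Model.

Variable (A : finType).

Local Notation base := (Z.of_nat #|A|.+1).

(** Letters have nonzero digits. Digit 0 marks the bottom of a register: code 0 is that of the empty
    word and stays 0 when a digit 0 is removed. *)
Definition digit (o : option A) : nat := if o is Some a then (enum_rank a).+1 else 0.

Lemma digit_lt o : digit o < #|A|.+1.
Proof. by case: o => //= a; rewrite ltnS ltn_ord. Qed.

Lemma digit_inj : injective digit.
Proof. by move=> [a|] [b|] //= [/ord_inj/enum_rank_inj ->]. Qed.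

Definition append (s : counters) (r : nat) (a : nat) : counters :=
  upd s r (base * s r + Z.of_nat a)%Z.

Definition last_digit (s : counters) (r : nat) : 'I_#|A|.+1 :=
  inord (Z.to_nat (s r mod base)%Z).

Definition drop_last (s : counters) (r : nat) : counters := upd s r (s r / base)%Z.

Lemma base_gt0 : (0 < base)%Z. Proof. lia. Qed.

Lemma last_digit_append s r (a : 'I_#|A|.+1) : last_digit (append s r a) r = a.
Proof.
rewrite /last_digit /append upd_same Z.add_comm Z.mul_comm Z_mod_plus_full.
have ha := ltn_ord a; rewrite Z.mod_small ?Nat2Z.id ?inord_val //; lia.
Qed.

Lemma drop_last_append s r (a : 'I_#|A|.+1) : drop_last (append s r a) r = s.
Proof.
rewrite /drop_last /append upd_same upd_upd Z.add_comm Z.mul_comm Z_div_plus_full.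
  by have ha := ltn_ord a; rewrite Z.div_small ?Z.add_0_l ?upd_id //; lia.
lia.
Qed.

Lemma append_drop_last s r : append (drop_last s r) r (last_digit s r) = s.
Proof.
rewrite /append /drop_last upd_same upd_upd /last_digit.
have := Z.mod_pos_bound (s r) _ base_gt0 => hm.
rewrite inordK; last by lia.
rewrite Z2Nat.id; last by lia.
by rewrite -Z.div_mod ?upd_id //; lia.
Qed.

(** * Labelled sheets of counter space *)

Definition label := counters -> Prop.

(* A copy of the space of counters, with a label on each point and a stream
   providing infinitely many copies of each labelling. *)
Definition sheet := (label * (nat -> 'I_#|A|.+1 * ('I_#|A| -> label)))%type.

Definition residual (r : nat) (a : 'I_#|A|.+1) (l : label) : label :=
  fun s => l (append s r a).

Definition merge (r : nat) (a : 'I_#|A|.+1) (l : label) (others : 'I_#|A| -> label) :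
    label :=
  fun s => if unlift a (last_digit s r) is Some j then others j (drop_last s r)
           else l (drop_last s r).

Lemma residual_merge r a l others : residual r a (merge r a l others) = l.
Proof.
apply: funext => s; rewrite /residual /merge last_digit_append unlift_none.
by rewrite drop_last_append.
Qed.

Lemma residual_lift_merge r a j l others :
  residual r (lift a j) (merge r a l others) = others j.
Proof.
apply: funext => s; rewrite /residual /merge last_digit_append liftK.
by rewrite drop_last_append.
Qed.

Lemma merge_residual r a l :
  merge r a (residual r a l) (fun j => residual r (lift a j) l) = l.
Proof.
apply: funext => s; rewrite /merge /residual.
by case: unliftP => [j|] e; rewrite -e append_drop_last.
Qed.

(** One half of a bijection between sheets and pairs of a sheet and a residue: the labelling is
    placed on one residue class of register [r]. The head of the stream names the class and labels
    the others. *)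
Definition split_sheet (r : nat) (o : sheet) : sheet * 'I_#|A|.+1 :=
  ((merge r (o.2 0).1 o.1 (o.2 0).2, fun k => o.2 k.+1), (o.2 0).1).

Definition join_sheet (r : nat) (o : sheet) (a : 'I_#|A|.+1) : sheet :=
  (residual r a o.1,
   fun k => if k is k'.+1 then o.2 k' else (a, fun j => residual r (lift a j) o.1)).

Lemma split_sheetK r o : join_sheet r (split_sheet r o).1 (split_sheet r o).2 = o.
Proof.
case: o => l mu; rewrite /join_sheet /split_sheet /= residual_merge; congr (_, _).
apply: funext => -[|k] //; case: (mu 0) => a others /=; congr (_, _).
by apply: funext => j; rewrite residual_lift_merge.
Qed.

Lemma join_sheetK r o a : split_sheet r (join_sheet r o a) = (o, a).
Proof.
case: o => l mu; rewrite /split_sheet /join_sheet /=; congr ((_, _), _).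
exact: merge_residual.
Qed.

(** A transposition, used to prescribe the image of one sheet under the bijection above. *)
Definition exchange (T : Type) (x y z : T) : T :=
  if `[< z = x >] then y else if `[< z = y >] then x else z.

Lemma exchangeL T (x y : T) : exchange x y x = y.
Proof. by rewrite /exchange asboolT. Qed.

Lemma exchangeR T (x y : T) : exchange x y y = x.
Proof. by rewrite /exchange; case: asboolP => [//|_]; rewrite asboolT. Qed.

Lemma exchangeK T (x y : T) : involutive (exchange x y).
Proof.
move=> z; rewrite {2}/exchange; case: asboolP => [->|zx]; first exact: exchangeR.
case: asboolP => [->|zy]; first exact: exchangeL.
by rewrite /exchange !asboolF.
Qed.

(** * The permutation model *)

Variable (D : program A).

(* Acceptance of the machine obtained from [D] by letting each register hold an
   arbitrary integer instead of the base-[#|A|.+1] code of a word. *)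
Inductive accepts : nat -> counters -> Prop :=
| accepts_halt pc s : onth D pc = Some (Halt A true) -> accepts pc s
| accepts_push pc s r a : onth D pc = Some (Push r a) ->
    accepts pc.+1 (append s r (digit (Some a))) -> accepts pc s
| accepts_pop pc s r k o : onth D pc = Some (Pop r k) ->
    accepts (k o) s -> accepts pc (append s r (digit o)).

Definition main_sheet (p : nat) : sheet :=
  (accepts p, fun=> (ord0, fun _ _ => False)).

(** The last pair [(u, v)] is a fibre for the Heisenberg group: [Pt] translates [u], [Kap] shears
    [v] by [u], and commutators translate [v]. *)
Definition point := (sheet * counters * (Z * Z))%type.

Definition zero_counters : counters := fun=> 0%Z.

(** The exchange makes [main_sheet p1] split into [main_sheet p2] with residue [a]. *)
Definition sub_forward r a p1 p2 (x : point) : point :=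
  let y := split_sheet r
    (exchange (main_sheet p1) (join_sheet r (main_sheet p2) (inord a)) x.1.1) in
  (y.1, append x.1.2 r y.2, x.2).

Definition sub_backward r a p1 p2 (x : point) : point :=
  (exchange (main_sheet p1) (join_sheet r (main_sheet p2) (inord a))
     (join_sheet r x.1.1 (last_digit x.1.2 r)), drop_last x.1.2 r, x.2).

(* [Kap] and [Pt p] do not commute in the fibre over a point with false label. *)
Definition gen_act (g : gen * bool) (x : point) : point :=
  let: (o, s, (u, v)) := x in
  match g with
  | (Cnt i, b) => (o, upd s i (if b then s i + 1 else s i - 1)%Z, (u, v))
  | (Pt p, b) => if `[< (o, s) = (main_sheet p, zero_counters) >]
                 then (o, s, ((if b then u + 1 else u - 1)%Z, v)) else x
  | (Sub _ r a p1 p2, true) => sub_forward r a p1 p2 x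
  | (Sub _ r a p1 p2, false) => sub_backward r a p1 p2 x
  | (Kap, b) => if `[< o.1 s >] then x
                else (o, s, (u, if b then v - u else v + u)%Z)
  end.

Definition lift_point (x : point) : point :=
  let: (o, s, (u, v)) := x in (o, s, (u, v + 1)%Z).

Lemma sub_forwardK r a p1 p2 :
  cancel (sub_forward r a p1 p2) (sub_backward r a p1 p2).
Proof.
move=> [[o s] uv]; rewrite /sub_forward /sub_backward /=.
by rewrite last_digit_append drop_last_append split_sheetK exchangeK.
Qed.

Lemma sub_backwardK r a p1 p2 :
  cancel (sub_backward r a p1 p2) (sub_forward r a p1 p2).
Proof.
move=> [[o s] uv]; rewrite /sub_forward /sub_backward; cbn [fst snd].
by rewrite exchangeK join_sheetK append_drop_last.
Qed.

Lemma gen_act_action : is_action gen_act.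
Proof.
move=> [i|p|f r a p1 p2|] b [[o s] [u v]] /=.
- rewrite upd_same upd_upd; congr (_, _, _); rewrite -[RHS](upd_id s i).
  by congr upd; case: b => /=; lia.
- case: asboolP => /= h; last by rewrite asboolF.
  by rewrite asboolT //; congr (_, _, (_, _)); case: b => /=; lia.
- case: b => /=.
    by have := sub_forwardK r a p1 p2 (o, s, (u, v)).
  by have := sub_backwardK r a p1 p2 (o, s, (u, v)).
- case: asboolP => /= h; first by rewrite asboolT.
  by rewrite asboolF //; congr (_, _, (_, _)); case: b => /=; lia.
Qed.

Lemma gen_act_lift g x : gen_act g (lift_point x) = lift_point (gen_act g x).
Proof.
case: g x => [[i|p|f r a p1 p2|] b] [[o s] [u v]] //=.
- by case: asboolP.
- by case: b.
- by case: asboolP => //= _; congr (_, _, (_, _)); case: b; lia.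
Qed.

Lemma lift_point_free n x : iter n.+1 lift_point x <> x.
Proof.
have iterE m : iter m lift_point x = (x.1, (x.2.1, x.2.2 + Z.of_nat m)%Z).
  elim: m => [|m IH]; last by rewrite iterS IH /= Nat2Z.inj_succ; case: (x.1) => o s;
    congr (_, (_, _)); lia.
  by case: x => [os [u v]] /=; congr (_, (_, _)); lia.
by rewrite iterE; case: x {iterE} => [os [u v]] /= [] ; lia.
Qed.

Definition commute_rel (g h : gen) : seq (gen * bool) :=
  [:: (g, true); (h, true); (g, false); (h, false)].

(** For an instruction letter [S], this says [x_r S = S x_r^(#|A| + 1)]. *)
Definition shift_rel f r a p1 p2 : seq (gen * bool) :=
  [:: (Cnt r, true); (Sub f r a p1 p2, true)] ++ nseq #|A|.+1 (Cnt r, false) ++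
  [:: (Sub f r a p1 p2, false)].

(** [S] conjugates [t_p1] into the conjugate of [t_p2] by [x_r^a]. With [shift_rel], the translate
    of [t_p1] by [x_r^n] goes to that of [t_p2] by [x_r^((#|A| + 1) n + a)]. *)
Definition point_rel f r a p1 p2 : seq (gen * bool) :=
  [:: (Sub f r a p1 p2, false); (Pt p1, true); (Sub f r a p1 p2, true)] ++
  nseq a (Cnt r, false) ++ (Pt p2, false) :: nseq a (Cnt r, true).

Lemma act_commute_rel g h :
  (forall x, gen_act (h, true) (gen_act (g, true) x) =
             gen_act (g, true) (gen_act (h, true) x)) ->
  forall x, run_action gen_act x (commute_rel g h) = x.
Proof.
move=> gh x; rewrite /= gh.
by rewrite (gen_act_action g true) (gen_act_action h true).
Qed.

Lemma act_counters i j x : run_action gen_act x (commute_rel (Cnt i) (Cnt j)) = x.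
Proof.
apply: act_commute_rel => {x} -[[o s] [u v]] /=; congr (_, _, _).
by apply: funext => k; rewrite /upd; do !case: eqP => //; congruence.
Qed.

Lemma act_nseq_counter n r b o s uv :
  run_action gen_act (o, s, uv) (nseq n (Cnt r, b)) =
  (o, upd s r (if b then s r + Z.of_nat n else s r - Z.of_nat n)%Z, uv).
Proof.
case: uv => u v; elim: n s => [|n IH] s.
  rewrite /= -[in LHS](upd_id s r); congr (_, upd _ _ _, _); case: b => /=; lia.
rewrite [LHS]/= IH upd_same upd_upd Nat2Z.inj_succ.
by congr (_, upd _ _ _, _); case: b {IH}; lia.
Qed.

Lemma gen_act_sub f r a p1 p2 b x : gen_act (Sub f r a p1 p2, b) x =
  if b then sub_forward r a p1 p2 x else sub_backward r a p1 p2 x.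
Proof. by case: x b => [[o s] [u v]] []. Qed.

Lemma append_upd s i r v c : i != r -> append (upd s i v) r c = upd (append s r c) i v.
Proof. by move=> ir; rewrite /append upd_swap // /upd eq_sym (negbTE ir). Qed.

Lemma act_sub_other f r a p1 p2 i x : i != r ->
  run_action gen_act x (commute_rel (Cnt i) (Sub f r a p1 p2)) = x.
Proof.
move=> ir; apply: act_commute_rel => {x} -[[o s] [u v]] /=.
by rewrite /sub_forward /= append_upd // /append /upd (negbTE ir).
Qed.

Lemma act_sub_self f r a p1 p2 x :
  run_action gen_act x (shift_rel f r a p1 p2) = x.
Proof.
rewrite /shift_rel !run_action_cat; case: x => [[o s] [u v]].
rewrite [run_action _ _ [:: _; _]]/= /sub_forward; cbn [fst snd].
set y := split_sheet _ _; rewrite act_nseq_counter.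
have -> : upd (append (upd s r (s r + 1)%Z) r y.2) r
    (append (upd s r (s r + 1)%Z) r y.2 r - base)%Z = append s r y.2.
  by rewrite /append !upd_same !upd_upd; congr upd; lia.
exact: (sub_forwardK r a p1 p2 (o, s, (u, v))).
Qed.

Lemma sub_forward_main r a p1 p2 s uv : a < #|A|.+1 ->
  sub_forward r a p1 p2 (main_sheet p1, s, uv) = (main_sheet p2, append s r a, uv).
Proof.
move=> ha; rewrite /sub_forward; cbn [fst snd]; rewrite exchangeL join_sheetK.
by cbn [fst snd]; rewrite inordK.
Qed.

(** Both conjugates act over a single point, the one of [main_sheet p2] where counter [r] is [a] and
    the others vanish. *)
Lemma act_point f r a p1 p2 x : a < #|A|.+1 ->
  run_action gen_act x (point_rel f r a p1 p2) = x.
Proof.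
move=> ha; rewrite /point_rel run_action_cat -[RHS](sub_backwardK r a p1 p2).
have -> : run_action gen_act x [:: (Sub f r a p1 p2, false); (Pt p1, true);
      (Sub f r a p1 p2, true)] =
    sub_forward r a p1 p2 (gen_act (Pt p1, true) (sub_backward r a p1 p2 x)).
  by rewrite /run_action /foldl !gen_act_sub.
move: (sub_backward r a p1 p2 x) => {x} [[o s] [u v]].
have zero_append : upd zero_counters r (0 + Z.of_nat a)%Z = append zero_counters r a.
  by rewrite /append /zero_counters; congr upd; lia.
have back b w t : upd (upd w r t) r (upd w r t r + b)%Z = upd w r (t + b)%Z.
  by rewrite upd_same upd_upd.
rewrite run_action_cat -cat1s run_action_cat /=; case: asboolP => [[-> ->]|ne].
  rewrite !sub_forward_main // act_nseq_counter.
  have -> : upd (append zero_counters r a) r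
      (append zero_counters r a r - Z.of_nat a)%Z = zero_counters.
    rewrite /append upd_upd upd_same -[RHS](upd_id _ r); congr upd.
    by rewrite /zero_counters; lia.
  rewrite /= asboolT // act_nseq_counter zero_append; congr (_, _, (_, _)); lia.
case def_y : (sub_forward r a p1 p2 (o, s, (u, v))) => [[o' s'] uv'].
have uvE : uv' = (u, v) by move: def_y; rewrite /sub_forward => -[].
rewrite act_nseq_counter uvE /= asboolF => [|[eo es]].
  rewrite act_nseq_counter upd_same upd_upd; congr (_, _, _).
  by rewrite -[RHS](upd_id _ r); congr upd; lia.
(* By injectivity of [sub_forward], no other point reaches the place where [Pt p2] acts. *)
case: ne; suff : (o, s, (u, v)) = (main_sheet p1, zero_counters, (u, v)) by case=> -> ->.
apply: (can_inj (sub_forwardK r a p1 p2)); rewrite def_y sub_forward_main // uvE eo.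
congr (_, _, _); rewrite -zero_append -es upd_upd -[LHS](upd_id _ r).
by congr upd; move/(congr1 (fun w => w r)): es; rewrite upd_same /zero_counters; lia.
Qed.

(** The exchanged sheets have equal labels by the assumed equivalence, and splitting carries labels
    along with points. Since the effect of [Kap] on a fibre depends only on the label, it commutes
    with such letters. *)
Lemma sub_forward_label r a p1 p2 o s uv :
  (forall s, accepts p1 s <-> accepts p2 (append s r a)) -> a < #|A|.+1 ->
  let y := sub_forward r a p1 p2 (o, s, uv) in y.1.1.1 y.1.2 = o.1 s.
Proof.
move=> inv ha; rewrite /sub_forward; cbn [fst snd].
set m := exchange _ _ o.
have -> : o.1 = m.1.
  rewrite /m /exchange; case: asboolP => [->|_].
    rewrite /main_sheet /join_sheet /=; apply: funext => t; rewrite /residual inordK //.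
    exact/propext.
  case: asboolP => [->|//]; rewrite /main_sheet /join_sheet /=.
  by apply: funext => t; rewrite /residual inordK //; apply/esym/propext.
rewrite /split_sheet; cbn [fst snd].
have := residual_merge r (m.2 0).1 m.1 (m.2 0).2.
by move/(congr1 (fun l => l s)).
Qed.

Lemma act_kappa_sub r a p1 p2 x :
  (forall s, accepts p1 s <-> accepts p2 (append s r a)) -> a < #|A|.+1 ->
  run_action gen_act x (commute_rel Kap (Sub false r a p1 p2)) = x.
Proof.
move=> inv ha; apply: act_commute_rel => {x} -[[o s] [u v]].
have e uv := sub_forward_label o s uv inv ha.
rewrite [gen_act (Kap, true) (o, s, _)]/=.
have fE uv : sub_forward r a p1 p2 (o, s, uv) =
    ((sub_forward r a p1 p2 (o, s, (u, v))).1, uv) by [].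
rewrite [gen_act (Sub _ _ _ _ _, true) (o, s, _)]/= [in RHS]fE.
have := e (u, v); cbn zeta.
case: (sub_forward r a p1 p2 (o, s, (u, v))).1 fE => o' s' fE; cbn [fst snd] => e'.
by rewrite /gen_act e'; case: asboolP => h; rewrite fE.
Qed.

Lemma act_kappa_point p x : (forall s, accepts p s) ->
  run_action gen_act x (commute_rel Kap (Pt p)) = x.
Proof.
move=> acc; apply: act_commute_rel => {x} -[[o s] [u v]] /=.
have [[-> ->]|ne] := asboolP ((o, s) = (main_sheet p, zero_counters)).
  by rewrite /= asboolT //= asboolT //= asboolT.
by rewrite /=; case: asboolP => h /=; rewrite ?asboolF //= ?asboolT.
Qed.

(** * The relators of a program *)

Definition reg_of (i : instruction A) : nat :=
  match i with Push r _ => r | Pop r _ => r | Halt _ => 0 end.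

Definition reg_bound : nat := (\max_(i <- D) reg_of i).+1.

Definition is_accepting (pc : nat) : bool :=
  if onth D pc is Some (Halt true) then true else false.

(* [(r, a, p1, p2)] states that [p1] with register [r] holding [s] is equivalent
   to [p2] with register [r] holding [base * s + a]; in accepting positions such
   rules serve to empty the registers. *)
Definition instr_subs (pc : nat) : seq (nat * nat * nat * nat) :=
  match onth D pc with
  | Some (Push r a) => [:: (r, digit (Some a), pc, pc.+1)]
  | Some (Pop r k) => [seq (r, digit o, k o, pc) | o <- enum {: option A}]
  | Some (Halt true) =>
      [seq (r, a, pc, pc) | r <- iota 0 reg_bound, a <- iota 0 #|A|.+1]
  | _ => [::]
  end.

Definition subs : seq (nat * nat * nat * nat) :=
  flatten [seq instr_subs pc | pc <- iota 0 (size D)].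

(** Writing a digit into register 0 at position 0 may change acceptance, hence the flag that
    excludes these letters from [kappa_rels]. *)
Definition load (a : A) : gen := Sub true 0 (digit (Some a)) 0 0.

Definition flagged_subs : seq (bool * nat * nat * nat * nat) :=
  [seq (let: (r, a, p1, p2) := x in (false, r, a, p1, p2)) | x <- subs] ++
  [seq (true, 0%N, digit (Some a), 0%N, 0%N) | a <- enum A].

Definition counter_rels : seq (seq (gen * bool)) :=
  [seq commute_rel (Cnt i) (Cnt j) | i <- iota 0 reg_bound, j <- iota 0 reg_bound].

Definition sub_rels (x : bool * nat * nat * nat * nat) : seq (seq (gen * bool)) :=
  let: (f, r, a, p1, p2) := x in
  [:: shift_rel f r a p1 p2; point_rel f r a p1 p2] ++
  [seq commute_rel (Cnt i) (Sub f r a p1 p2) | i <- iota 0 reg_bound & i != r].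

Definition kappa_rels : seq (seq (gen * bool)) :=
  [seq (let: (r, a, p1, p2) := x in commute_rel Kap (Sub false r a p1 p2)) | x <- subs]
  ++ [seq commute_rel Kap (Pt pc) | pc <- iota 0 (size D) & is_accepting pc].

Definition program_rels : seq (seq (gen * bool)) :=
  counter_rels ++ flatten (map sub_rels flagged_subs) ++ kappa_rels.

Definition program_gens : seq gen :=
  [:: Kap; Pt 0] ++ map load (enum A) ++ map fst (flatten program_rels).

(** The first letter of a word is the last digit of its code, so it is loaded last. *)
Definition loads (w : seq A) : seq (gen * bool) := [seq (load a, true) | a <- rev w].
Definition unloads (w : seq A) : seq (gen * bool) := [seq (load a, false) | a <- w].

(* The commutator of [Kap] with the translate of [Pt 0] by the code of [w]. *)
Definition goal_word (w : seq A) : seq (gen * bool) :=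
  (Kap, false) :: unloads w ++ (Pt 0, false) :: loads w ++
  (Kap, true) :: unloads w ++ (Pt 0, true) :: loads w.

Lemma accepts_pushE pc r a s : onth D pc = Some (Push r a) ->
  accepts pc s <-> accepts pc.+1 (append s r (digit (Some a))).
Proof.
move=> h; split=> [acc|]; last exact: accepts_push.
case: acc h => {pc s} [pc s h|pc s r' a' h acc|pc s r' k o h acc] h';
  move: h'; rewrite h => -[] //.
by move=> <- <-.
Qed.

Lemma accepts_popE pc r k o s : onth D pc = Some (Pop r k) ->
  accepts (k o) s <-> accepts pc (append s r (digit o)).
Proof.
move=> h; split=> [|acc]; first exact: accepts_pop.
move: {-1}(append s r (digit o)) (erefl (append s r (digit o))) acc => s' def_s acc.
case: acc h def_s => {pc s'} [pc s' h|pc s' r' a' h acc|pc s' r' k' o' h acc] h';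
  move: h'; rewrite h => -[] // er ek es; rewrite er ek in acc es.
(* A counter determines its last digit and its quotient, so the inverted rule had the same digit and
   the same previous counters. *)
have eo : o' = o.
  apply: digit_inj; have := congr1 (fun t => last_digit t r) es.
  have := last_digit_append s r (Ordinal (digit_lt o)).
  have := last_digit_append s' r (Ordinal (digit_lt o')).
  by move=> /= -> -> [].
have := congr1 (fun t => drop_last t r) es; rewrite -eo.
have := drop_last_append s r (Ordinal (digit_lt o')).
have := drop_last_append s' r (Ordinal (digit_lt o')).
by move=> /= -> -> ->.
Qed.

Lemma subs_accepts r a p1 p2 : (r, a, p1, p2) \in subs ->
  a < #|A|.+1 /\ forall s, accepts p1 s <-> accepts p2 (append s r a).
Proof.
case/flattenP => l /mapP[pc _ ->]; rewrite /instr_subs.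
case def_i : (onth D pc) => [[r' a'|r' k|[]]|] //.
- rewrite inE => /eqP [-> -> -> ->]; split; first exact: (digit_lt (Some a')).
  by move=> s; apply: accepts_pushE.
- case/mapP=> o _ [-> -> -> ->]; split; first exact: digit_lt.
  by move=> s; apply: accepts_popE.
- case/allpairsPdep => r'' [a'' [_ ha [-> -> -> ->]]].
  rewrite mem_iota in ha; split=> // s.
  by split=> _; apply: accepts_halt.
Qed.

Lemma act_program_rels z x : z \in program_rels -> run_action gen_act x z = x.
Proof.
rewrite /program_rels mem_cat => /orP[|].
  by rewrite /counter_rels => /allpairsPdep [i [j [_ _ ->]]]; apply: act_counters.
rewrite mem_cat => /orP[/flattenP[l /mapP[[[[[f r] a] p1] p2] hf ->]]|].
- have ha : a < #|A|.+1.
    move: hf; rewrite mem_cat => /orP[/mapP[[[[r' a'] p1'] p2'] h]|/mapP[b _]].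
      by case=> _ _ -> _ _; have [] := subs_accepts h.
    by case=> _ _ -> _ _; apply: (digit_lt (Some b)).
  rewrite /sub_rels mem_cat => /orP[|h].
    by rewrite !inE => /orP[/eqP ->|/eqP ->]; [apply: act_sub_self|apply: act_point].
  have [i + ->] := mapP h.
  by rewrite mem_filter => /andP[ir _]; apply: act_sub_other.
- rewrite mem_cat => /orP[/mapP[[[[r a] p1] p2] h ->]|h].
    by have [ha inv] := subs_accepts h; apply: act_kappa_sub.
  have [pc + ->] := mapP h.
  rewrite mem_filter => /andP[hpc _]; apply: act_kappa_point => s.
  move: hpc; rewrite /is_accepting; case e : (onth D pc) => [[| |[]]|] // _.
  exact: accepts_halt.
Qed.

(** * Initial configurations and the goal word in the model *)

Definition word_code (w : seq A) : nat :=
  foldr (fun a n => #|A|.+1 * n + digit (Some a))%N 0 w.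

Definition start_counters (w : seq A) : counters :=
  upd zero_counters 0 (Z.of_nat (word_code w)).

Lemma start_counters_cons a w :
  append (start_counters w) 0 (digit (Some a)) = start_counters (a :: w).
Proof.
rewrite /append /start_counters upd_upd upd_same; congr upd.
by rewrite /word_code [foldr _ _ (_ :: _)]/= Nat2Z.inj_add Nat2Z.inj_mul.
Qed.

Lemma start_counters_nil : start_counters [::] = zero_counters.
Proof. by apply: funext => i; rewrite /start_counters /upd /=; case: eqP. Qed.

Lemma run_loads w uv :
  run_action gen_act (main_sheet 0, zero_counters, uv) (loads w) =
  (main_sheet 0, start_counters w, uv).
Proof.
rewrite /loads; elim: w => [|a w IH]; first by rewrite start_counters_nil.
rewrite rev_cons -cats1 map_cat run_action_cat IH -start_counters_cons.
transitivity (gen_act (load a, true) (main_sheet 0, start_counters w, uv)) => //.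
by rewrite /load gen_act_sub; apply: sub_forward_main; apply: digit_lt.
Qed.

Lemma unloadsE w : unloads w = inv_word (loads w).
Proof. by rewrite /unloads /loads /inv_word -map_comp -map_rev revK. Qed.

Lemma run_loads_fibre b w o s uv uv' :
  run_action gen_act (o, s, uv') [seq (load a, b) | a <- w] =
  ((run_action gen_act (o, s, uv) [seq (load a, b) | a <- w]).1, uv').
Proof.
elim: w o s => [|a w IH] o s //.
rewrite map_cons [run_action _ (_, _, uv') _]/= [run_action _ (_, _, uv) _]/=.
case: uv uv' IH => [u v] [u' v'] IH.
by case: b IH => IH; rewrite /sub_forward /sub_backward; apply: IH.
Qed.

(* Conjugating by [loads w] moves the action of [Pt 0] to the start point. *)
Lemma act_conj_point w b o s u v :
  run_action gen_act (o, s, (u, v)) (unloads w ++ (Pt 0, b) :: loads w) =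
  if `[< (o, s) = (main_sheet 0, start_counters w) >]
  then (o, s, ((if b then u + 1 else u - 1)%Z, v)) else (o, s, (u, v)).
Proof.
have inv := run_action_inv _ _ gen_act_action.
have inv' x : run_action gen_act (run_action gen_act x (unloads w)) (loads w) = x.
  by rewrite unloadsE -{2}(inv_wordK (loads w)) inv.
have fib := run_loads_fibre false w o s (u, v) (u, v).
rewrite run_action_cat -cat1s run_action_cat.
have back := inv' (o, s, (u, v)).
have : run_action gen_act (o, s, (u, v)) (unloads w) =
  ((run_action gen_act (o, s, (u, v)) (unloads w)).1, (u, v)) by exact: fib.
move: back; case: (run_action _ _ (unloads w)) => [[o1 s1] uv1] back [uvE].
rewrite uvE in back *; rewrite /=.
have [[eo es]|ne] := asboolP ((o1, s1) = _).
  move: back; rewrite eo es !run_loads => -[<- <-].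
  by rewrite asboolT.
rewrite back asboolF // => -[eo es]; case: ne.
have := congr1 (fun x => run_action gen_act x (unloads w)) back.
rewrite unloadsE inv eo es -(run_loads w (u, v)) inv => -[-> ->].
by [].
Qed.

(** Over the start point, labelled false, [(u, v)] becomes [(u, v + u)], [(u - 1, v + u)],
    [(u - 1, v + 1)], then [(u, v + 1)]. Elsewhere the conjugates of [Pt 0] are trivial and the two
    [Kap] cancel. *)
Lemma run_goal_word w x : ~ accepts 0 (start_counters w) ->
  run_action gen_act x (goal_word w) =
  if `[< x.1 = (main_sheet 0, start_counters w) >] then lift_point x else x.
Proof.
move=> nacc; case: x => [[o s] [u v]].
have -> : goal_word w = [:: (Kap, false)] ++
    (unloads w ++ (Pt 0, false) :: loads w) ++ [:: (Kap, true)] ++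
    (unloads w ++ (Pt 0, true) :: loads w) by rewrite /goal_word /= -!catA.
rewrite 3!run_action_cat [run_action _ _ [:: (Kap, false)]]/=; cbn [fst snd].
have [[-> ->]|ne] := asboolP ((o, s) = (main_sheet 0, start_counters w)).
  rewrite [(main_sheet 0).1 _]/= asboolF // act_conj_point asboolT //.
  rewrite [run_action _ _ [:: (Kap, true)]]/= asboolF //.
  rewrite act_conj_point asboolT //=; congr (_, _, (_, _)); lia.
case: asboolP => h; rewrite act_conj_point asboolF //.
  by rewrite [run_action _ _ [:: (Kap, true)]]/= asboolT // act_conj_point asboolF.
rewrite [run_action _ _ [:: (Kap, true)]]/= asboolF //.
rewrite act_conj_point asboolF //; congr (_, _, (_, _)); lia.
Qed.

Lemma program_model w : ~ accepts 0 (start_counters w) ->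
  exists (Xi : Type) (act : gen * bool -> Xi -> Xi) (shift : Xi -> Xi),
    [/\ is_action act,
        forall z, z \in program_rels -> forall xi, run_action act xi z = xi,
        forall x xi, act x (shift xi) = shift (act x xi),
        forall n xi, iter n.+1 shift xi <> xi &
        (forall xi, run_action act xi (goal_word w) = xi \/
                    run_action act xi (goal_word w) = shift xi)
        /\ exists xi, run_action act xi (goal_word w) = shift xi].
Proof.
move=> nacc; exists point, gen_act, lift_point; split.
- exact: gen_act_action.
- by move=> z hz x; apply: act_program_rels.
- exact: gen_act_lift.
- exact: lift_point_free.
split=> [x|]; first by rewrite run_goal_word //; case: ifP => _; [right|left].
exists (main_sheet 0, start_counters w, (0, 0)%Z).
by rewrite run_goal_word // asboolT.
Qed.

(** [accepts] ranges over all integers, but from codes of words the uniqueness of Euclidean division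
    leaves only the genuine step at each pop. *)
Lemma accepts_returns pc s (R : registers A) : accepts pc s ->
  s = (fun i => Z.of_nat (word_code (R i))) -> returns D pc R true.
Proof.
move=> acc; elim: acc R => {pc s} [pc s h|pc s r a h _ IH|pc s r k o h _ IH] R def_s.
- exact: returns_halt.
- apply: (returns_push h); apply: IH; rewrite def_s; apply: funext => i.
  rewrite /append /upd /set_reg; case: eqP => // _.
  by rewrite /word_code /= Nat2Z.inj_add Nat2Z.inj_mul.
- have sr : (base * s r + Z.of_nat (digit o))%Z = Z.of_nat (word_code (R r)).
    by rewrite -(congr1 (fun t => t r) def_s) /append upd_same.
  have sE i : i != r -> s i = Z.of_nat (word_code (R i)).
    by move=> /negbTE ir; rewrite -(congr1 (fun t => t i) def_s) /append /upd ir.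
  have ho := digit_lt o.
  case def_r : (R r) sr => [|a w] sr.
    case: o h IH sr ho {def_s} => [a|] h IH sr ho.
      (* A nonzero digit cannot end the code 0 of an empty register. *)
      have d0 : 0 < digit (Some a) by [].
      move: (digit (Some a)) ho d0 sr => d ho d0; rewrite [word_code _]/=.
      by case: (Z.lt_ge_cases (s r) 0) => ? ?; nia.
    apply: (returns_pop_empty h def_r); apply: IH; apply: funext => i.
    have [->|/sE //] := eqVneq i r; rewrite def_r; move: sr; rewrite /=; nia.
  have ha := digit_lt (Some a).
  have [sw od] : s r = Z.of_nat (word_code w) /\ digit o = digit (Some a).
    have codeE : word_code (a :: w) = (#|A|.+1 * word_code w + digit (Some a))%N by [].
    move: sr; rewrite codeE Nat2Z.inj_add Nat2Z.inj_mul => sr.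
    move: (digit (Some a)) (digit o) ha ho sr => d d' ha ho sr.
    have [||-> e] := Z.div_mod_unique _ _ _ _ _ _ _ sr; [lia|lia|].
    by split=> //; lia.
  move: IH h; rewrite (digit_inj od) => IH h.
  apply: (returns_pop h def_r); apply: IH; apply: funext => i.
  by rewrite /set_reg; have [->|/sE] := eqVneq i r.
Qed.

(** * The presented group *)

Definition code_of (R : registers A) : nat -> nat := fun i => word_code (R i).

End Model.

Section PresentedGroup.

Variables (G : countType) (rels : seq (seq (G * bool))).

Definition rel_eqb : rel (seq (G * bool)) := fun u v => `[< rel_eq rels u v >].

Lemma rel_eqb_refl : reflexive rel_eqb.
Proof. by move=> u; apply/asboolP; apply: rel_eq_refl. Qed.

Lemma rel_eqb_sym : symmetric rel_eqb.
Proof. by move=> u v; apply/asboolP/asboolP; apply: rel_eq_sym. Qed.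

Lemma rel_eqb_trans : transitive rel_eqb.
Proof.
by move=> v u w /asboolP uv /asboolP vw; apply/asboolP; apply: rel_eq_trans vw.
Qed.

Canonical rel_equiv := EquivRel rel_eqb rel_eqb_refl rel_eqb_sym rel_eqb_trans.

Definition pgroup := {eq_quot rel_equiv}%qT.
HB.instance Definition _ := Choice.on pgroup.

Definition pclass (u : seq (G * bool)) : pgroup := (\pi_pgroup u)%qT.

Lemma pclassP u v : pclass u = pclass v <-> rel_eq rels u v.
Proof. by split=> [/eqmodP /asboolP //|uv]; apply/eqmodP/asboolP. Qed.

Lemma pclass_surj a : exists u, a = pclass u.
Proof. by exists (repr a); rewrite /pclass reprK. Qed.

Lemma rel_eq_context u v x y : rel_eq rels u v -> rel_eq rels (x ++ u ++ y) (x ++ v ++ y).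
Proof.
elim=> {u v} [u|u v _ h|u v t _ h1 _ h2|u v g b|u v z hz].
- exact: rel_eq_refl.
- exact: rel_eq_sym.
- exact: rel_eq_trans h1 h2.
- by have := rel_eq_free rels (x ++ u) (v ++ y) g b; rewrite -!catA.
- by have := rel_eq_rel (x ++ u) (v ++ y) hz; rewrite -!catA.
Qed.

Lemma rel_eq_cat u u' v v' :
  rel_eq rels u u' -> rel_eq rels v v' -> rel_eq rels (u ++ v) (u' ++ v').
Proof.
move=> hu hv; apply: (@rel_eq_trans _ _ _ (u' ++ v)).
  exact: (rel_eq_context [::] v hu).
by have := rel_eq_context u' [::] hv; rewrite !cats0.
Qed.

Lemma rel_eq_invl u : rel_eq rels (inv_word u ++ u) [::].
Proof.
elim: u => [|[g b] u IH]; first exact: rel_eq_refl.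
have -> : inv_word ((g, b) :: u) ++ (g, b) :: u =
    inv_word u ++ [:: (g, ~~ b); (g, ~~ ~~ b)] ++ u.
  by rewrite negbK /inv_word /= rev_cons -cats1 -catA.
exact: rel_eq_trans (rel_eq_free _ _ _ _ _) IH.
Qed.

Definition pmul (a b : pgroup) : pgroup := pclass (repr a ++ repr b).
Definition pinv (a : pgroup) : pgroup := pclass (inv_word (repr a)).

Lemma pmulE u v : pmul (pclass u) (pclass v) = pclass (u ++ v).
Proof. by apply/pclassP; apply: rel_eq_cat; apply/pclassP; rewrite /pclass reprK. Qed.

Lemma pmulA : associative pmul.
Proof.
move=> a b c; have [u ->] := pclass_surj a; have [v ->] := pclass_surj b.
by have [w ->] := pclass_surj c; rewrite !pmulE catA.
Qed.

Lemma pmul1 : left_id (pclass [::]) pmul.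
Proof. by move=> a; have [u ->] := pclass_surj a; rewrite pmulE. Qed.

Lemma pmulr1 : right_id (pclass [::]) pmul.
Proof. by move=> a; have [u ->] := pclass_surj a; rewrite pmulE cats0. Qed.

Lemma pmulV : left_inverse (pclass [::]) pinv pmul.
Proof.
move=> a; rewrite -[X in pmul _ X]reprK -/(pclass _) pmulE.
by apply/pclassP; apply: rel_eq_invl.
Qed.

Lemma pmulrV : right_inverse (pclass [::]) pinv pmul.
Proof.
move=> a; rewrite -[X in pmul X]reprK -/(pclass _) pmulE.
by apply/pclassP; have := rel_eq_invl (inv_word (repr a)); rewrite inv_wordK.
Qed.

HB.instance Definition _ := isGroup.Build pgroup pmulA pmul1 pmulr1 pmulV pmulrV.

Lemma pclass_cat u v : pclass (u ++ v) = pclass u * pclass v.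
Proof. by rewrite -pmulE. Qed.

Lemma pclass_inv u : pclass (inv_word u) = (pclass u)^-1.
Proof.
apply/esym/mulg1_eq; rewrite -pclass_cat; apply/pclassP.
by have := rel_eq_invl (inv_word u); rewrite inv_wordK.
Qed.

Lemma pclass_rel z : z \in rels -> pclass z = 1.
Proof.
by move=> hz; apply/pclassP; have := rel_eq_rel [::] [::] hz; rewrite cats0.
Qed.

Definition pgen (g : G) : pgroup := pclass [:: (g, true)].

Lemma pclass_letter g b : pclass [:: (g, b)] = if b then pgen g else (pgen g)^-1.
Proof. by case: b => //; rewrite -pclass_inv. Qed.

Lemma pclass_cons g b u :
  pclass ((g, b) :: u) = (if b then pgen g else (pgen g)^-1) * pclass u.
Proof. by rewrite -pclass_letter -pclass_cat. Qed.

Lemma pclass_nseq n g b : pclass (nseq n (g, b)) =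
  if b then pgen g ^+ n else (pgen g)^-1 ^+ n.
Proof.
elim: n => [|n IH]; first by case: b.
by rewrite pclass_cons IH; case: b {IH}; rewrite expgS.
Qed.

End PresentedGroup.

Lemma conj_commute (H : groupType) (k a s : H) : commute k s ->
  commute k a <-> commute k (a ^ s).
Proof.
move=> ks; have c u t : commute k t -> commute k u -> commute k (u ^ t).
  by move=> kt ku; rewrite conjgE; apply: commuteM; [apply: commuteV|apply: commuteM].
split; first exact: c.
by move/(c _ s^-1); rewrite conjgK; apply; apply: commuteV.
Qed.

(** * Products of commuting powers *)

Section Powers.

Variables (H : groupType) (d : nat) (x : nat -> H).

Definition powers (s : nat -> nat) : H := \prod_(i < d) x i ^+ s i.

Lemma powers_swap s s' y :
  (forall i, i < d -> x i ^+ s i * y = y * x i ^+ s' i) ->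
  powers s * y = y * powers s'.
Proof.
rewrite /powers => h; elim: (index_enum _) => [|i l IH].
  by rewrite !big_nil mulg1 mul1g.
by rewrite !big_cons -mulgA IH mulgA h // mulgA.
Qed.

Hypothesis x_commute : forall i j, i < d -> j < d -> commute (x i) (x j).

Lemma powersD s s' : powers (fun i => s i + s' i)%N = powers s * powers s'.
Proof.
rewrite -prodgM_commute => [|i j _ _]; last exact/commuteX2/x_commute.
by apply: eq_bigr => i _; rewrite expgnDr.
Qed.

Lemma powers_single r a : r < d -> powers (fun i => if i == r then a else 0%N) = x r ^+ a.
Proof.
move=> hr; transitivity (\prod_(i < d | i == Ordinal hr) x i ^+ a); last by rewrite big_pred1_eq.
rewrite big_mkcond; apply: eq_bigr => i _; rewrite -val_eqE /=.
by case: eqP.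
Qed.

Lemma powers_add s r a : r < d ->
  powers (fun i => if i == r then s i + a else s i)%N = x r ^+ a * powers s.
Proof.
move=> hr; rewrite -(powers_single a hr) -powersD; apply: eq_bigr => i _.
by case: eqP => _; rewrite ?add0n // addnC.
Qed.

End Powers.

(** * An accepting run makes the goal word trivial *)

Section Completeness.

Variables (A : finType) (D : program A).

Local Notation group := (pgroup (program_rels D)).
Local Notation gg := (pgen (program_rels D)).
Local Notation d := (reg_bound D).

Definition updn (s : nat -> nat) (r v : nat) : nat -> nat :=
  fun i => if i == r then v else s i.

Lemma commute_relP g h : commute_rel g h \in program_rels D -> commute (gg g) (gg h).
Proof.
move/pclass_rel; rewrite /commute_rel !pclass_cons mulgA mulgA mulgA.
rewrite -[pclass _ [::]]/(1 : group) mulg1 => /divg1_eq/eqP.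
by rewrite divg_eq => /eqP.
Qed.

Lemma counters_commute i j : i < d -> j < d -> commute (gg (Cnt i)) (gg (Cnt j)).
Proof.
move=> hi hj; apply: commute_relP; rewrite mem_cat; apply/orP; left.
by apply/allpairsPdep; exists i, j; rewrite !mem_iota.
Qed.

Lemma kappa_sub_commute r a p1 p2 : (r, a, p1, p2) \in subs D ->
  commute (gg Kap) (gg (Sub false r a p1 p2)).
Proof.
move=> h; apply: commute_relP; rewrite !mem_cat; apply/orP; right; apply/orP; right.
by apply/orP; left; apply/mapP; exists (r, a, p1, p2).
Qed.

Lemma kappa_point_commute pc : is_accepting D pc -> commute (gg Kap) (gg (Pt pc)).
Proof.
move=> h; apply: commute_relP; rewrite !mem_cat; apply/orP; right; apply/orP; right.
apply/orP; right; apply/mapP; exists pc => //; rewrite mem_filter h mem_iota /= add0n.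
move: h; rewrite /is_accepting; case e : (onth D pc) => [i|] // _.
by rewrite -onthTE e.
Qed.

Lemma sub_relsP f r a p1 p2 z : (f, r, a, p1, p2) \in flagged_subs D ->
  z \in sub_rels D (f, r, a, p1, p2) -> pclass (program_rels D) z = 1.
Proof.
move=> hf hz; apply: pclass_rel; rewrite !mem_cat; apply/orP; right.
by apply/orP; left; apply/flattenP; eexists; [apply: map_f; exact: hf|].
Qed.

Definition point_at (p : nat) (s : nat -> nat) : group :=
  gg (Pt p) ^ powers d (fun i => gg (Cnt i)) s.

(** Moving [S] across the translate multiplies the exponent of [x_r] by the base and fixes the
    others; [point_rel] then contributes [x_r^a]. *)
Lemma point_at_sub f r a p1 p2 s : (f, r, a, p1, p2) \in flagged_subs D -> r < d ->
  point_at p1 s ^ gg (Sub f r a p1 p2) =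
  point_at p2 (updn s r (#|A|.+1 * s r + a)).
Proof.
move=> hf hr; set S := gg _; pose P := powers d (fun i => gg (Cnt i)).
pose s' := updn s r (#|A|.+1 * s r).
have other i : i < d -> i != r -> gg (Cnt i) * S = S * gg (Cnt i).
  move=> hi ir; apply: (_ : commute _ _); apply: commute_relP.
  rewrite !mem_cat; apply/orP; right; apply/orP; left; apply/flattenP.
  eexists; first by apply: map_f; exact: hf.
  rewrite mem_cat; apply/orP; right; apply/mapP; exists i => //.
  by rewrite mem_filter ir mem_iota.
have self : gg (Cnt r) * S = S * gg (Cnt r) ^+ #|A|.+1.
  have : shift_rel A f r a p1 p2 \in sub_rels D (f, r, a, p1, p2) by rewrite inE eqxx.
  move/(sub_relsP hf); rewrite /shift_rel !pclass_cat !pclass_cons pclass_nseq.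
  rewrite -![pclass _ [::]]/(1 : group) !mulg1 !mulgA => /divg1_eq/eqP.
  by rewrite expVgn !divg_eq -mulgA -expgSr => /eqP.
have PS : P s * S = S * P s'.
  apply: powers_swap => i hi; rewrite /s' /updn.
  have [->|ir] := eqVneq i r; last first.
    suff c : commute S (gg (Cnt i) ^+ s i) by exact: esym c.
    by apply: commuteX; apply: commute_sym; apply: other.
  rewrite expgnA; elim: (s r) => [|n IH]; first by rewrite !expg0 mulg1 mul1g.
  transitivity (gg (Cnt r) ^+ n * S * gg (Cnt r) ^+ #|A|.+1).
    by rewrite [in LHS]expgSr -!mulgA self.
  by rewrite IH -mulgA [X in _ = _ * X]expgSr.
have pt : gg (Pt p1) ^ S = gg (Pt p2) ^ (gg (Cnt r) ^+ a).
  have : point_rel f r a p1 p2 \in sub_rels D (f, r, a, p1, p2) by rewrite !inE eqxx orbT.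
  move/(sub_relsP hf); rewrite /point_rel !pclass_cat !pclass_cons !pclass_nseq.
  rewrite -![pclass _ [::]]/(1 : group) !mulg1 -/S expVgn => e.
  by apply: divg1_eq; rewrite -conjVg.
rewrite /point_at -[powers _ _]/P -conjgM PS conjgM pt -conjgM; congr (_ ^ _).
rewrite -powers_add //; last exact: counters_commute.
by apply: eq_bigr => i _; rewrite /s' /updn; case: eqP => [->|].
Qed.

Lemma mem_subs pc x : x \in instr_subs D pc -> x \in subs D.
Proof.
move=> hx; apply/flattenP; exists (instr_subs D pc) => //; apply: map_f.
rewrite mem_iota /= add0n; move: hx; rewrite /instr_subs.
by case e : (onth D pc) => [i|] // _; rewrite -onthTE e.
Qed.

Lemma reg_of_lt pc i : onth D pc = Some i -> reg_of i < d.
Proof.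
rewrite /reg_bound ltnS; elim: D pc => [|j D' IH] [|pc] //=.
  by case=> ->; rewrite big_cons leq_maxl.
by move/IH => h; rewrite big_cons; apply: leq_trans h (leq_maxr _ _).
Qed.

(** The counterpart of acceptance in the group; the rules in [subs] transport it both ways. *)
Definition known (p : nat) (s : nat -> nat) : Prop := commute (gg Kap) (point_at p s).

Lemma known_sub r a p1 p2 s : (r, a, p1, p2) \in subs D -> r < d ->
  known p1 s <-> known p2 (updn s r (#|A|.+1 * s r + a)).
Proof.
move=> h hr; rewrite /known -(@point_at_sub false r a p1 p2) //.
  exact/conj_commute/(kappa_sub_commute h).
by rewrite mem_cat; apply/orP; left; apply/mapP; exists (r, a, p1, p2).
Qed.

Lemma point_at_ext p s s' : (forall i, i < d -> s i = s' i) -> point_at p s = point_at p s'.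
Proof.
by move=> ss; rewrite /point_at /powers; congr (_ ^ _); apply: eq_bigr => i _; rewrite ss.
Qed.

Hypothesis A_gt0 : 0 < #|A|.

(** The relator covers only [t_pc] itself, while a run may halt with nonempty registers. The rules
    at [pc] strip last digits; the base is at least 2, so the sum of the counters decreases until
    all vanish. *)
Lemma known_accepting pc s : is_accepting D pc -> known pc s.
Proof.
move=> hpc; have [n] := ubnP (\sum_(i < d) s i); elim: n s => // n IH s.
rewrite ltnS => hs.
have [/existsP[r sr]|] := boolP [exists i : 'I_d, s i != 0]; last first.
  rewrite negb_exists => /forallP s0; rewrite /known (@point_at_ext _ s (fun=> 0)).
    rewrite /point_at /powers big1 => [|i _]; last by rewrite expg0.
    by rewrite conjg1; apply: kappa_point_commute.
  by move=> i hi; apply/eqP; have := s0 (Ordinal hi); rewrite negbK.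
pose a := s r %% #|A|.+1; pose s' := updn s r (s r %/ #|A|.+1).
have h : ((r : nat), a, pc, pc) \in subs D.
  apply: (@mem_subs pc); move: hpc; rewrite /is_accepting /instr_subs.
  case: (onth D pc) => [[| |[]]|] // _; apply/allpairsPdep; exists (r : nat), a.
  by rewrite !mem_iota /= !add0n ltn_ord ltn_pmod.
have -> : s = updn s' r (#|A|.+1 * s' r + a).
  apply: funext => i; rewrite /s' /updn eqxx; case: eqP => [->|//].
  by rewrite mulnC -divn_eq.
apply: (proj1 (known_sub s' h (ltn_ord r))); apply: IH; apply: leq_trans hs.
rewrite (bigD1 r) //= [X in _ < X](bigD1 r) //= /s' {1}/updn eqxx.
rewrite -addSn; apply: leq_add; first by rewrite ltn_Pdiv // lt0n.
by apply: leq_sum => i /negbTE; rewrite /updn -val_eqE /= => ->.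
Qed.

Lemma returns_known pc R b : returns D pc R b -> b -> known pc (code_of R).
Proof.
have codes R' r v : code_of (set_reg R' r v) = updn (code_of R') r (word_code v).
  by apply: funext => i; rewrite /code_of /set_reg /updn; case: eqP.
elim=> {pc R b} [pc R b h|pc R b r a h _ IH|pc R b r k h Rr _ IH|pc R b r k a v h Rr _ IH] bt.
- by apply: known_accepting; rewrite /is_accepting h; case: b bt {h}.
- have hs : (r, digit (Some a), pc, pc.+1) \in subs D.
    by apply: (@mem_subs pc); rewrite /instr_subs h mem_head.
  by apply/(known_sub _ hs (reg_of_lt h)); move: (IH bt); rewrite codes.
- have hs : (r, digit (@None A), k None, pc) \in subs D.
    by apply: (@mem_subs pc); rewrite /instr_subs h; apply/mapP; exists None; rewrite ?mem_enum.
  (* An empty register has code 0, and appending the digit 0 of [None] leaves it unchanged. *)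
  have /(known_sub _ hs (reg_of_lt h)) := IH bt; congr known; apply: funext => i.
  by rewrite /updn; case: eqP => [->|//]; rewrite /code_of Rr /= muln0.
- have hs : (r, digit (Some a), k (Some a), pc) \in subs D.
    by apply: (@mem_subs pc); rewrite /instr_subs h; apply/mapP; exists (Some a); rewrite ?mem_enum.
  have /(known_sub _ hs (reg_of_lt h)) := IH bt; congr known; apply: funext => i.
  rewrite codes /updn eqxx; case: eqP => [->|//].
  by rewrite /code_of Rr.
Qed.

Lemma pclass_loads (w : seq A) : point_at 0 (code_of (initial_registers w)) =
  gg (Pt 0) ^ pclass (program_rels D) (loads w).
Proof.
elim: w => [|a w IH].
  rewrite /point_at /powers big1 // => i _.
  by rewrite /code_of /initial_registers; case: (i : nat) => [|j]; rewrite expg0.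
rewrite /loads rev_cons -cats1 map_cat pclass_cat conjgM -/(loads w) -IH.
rewrite [map _ _]/= pclass_letter (@point_at_sub true 0 _ 0 0) //.
  congr point_at; apply: funext => -[|i] //; rewrite /updn /=.
rewrite mem_cat; apply/orP; right; apply/mapP; exists a => //; exact: mem_enum.
Qed.

Lemma returns_rel_eq (w : seq A) : returns D 0 (initial_registers w) true ->
  rel_eq (program_rels D) (goal_word w) [::].
Proof.
move/returns_known => /(_ isT); rewrite /known pclass_loads => c.
apply/pclassP; rewrite -[RHS]/(1 : group) /goal_word unloadsE.
rewrite !(pclass_cons, pclass_cat) !pclass_inv.
transitivity ([~ gg Kap, gg (Pt 0) ^ pclass (program_rels D) (loads w)]).
  by rewrite commgEl !conjgE !invgM !invgK !mulgA.
exact/eqP/commgP.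
Qed.

End Completeness.

(** * Programs *)

Section Programs.

Variable (A : finType).

Lemma returns_det (P : program A) pc R b b' :
  returns P pc R b -> returns P pc R b' -> b = b'.
Proof.
move=> h; elim: h b' => {pc R b}.
- move=> pc R b h b' h'; case: h' h => {pc R b'}.
  + by move=> pc R b' -> [].
  + by move=> pc R b' r a ->.
  + by move=> pc R b' r k ->.
  + by move=> pc R b' r k a v ->.
- move=> pc R b r a h _ IH b' h'; case: h' h IH => {pc R b'}.
  + by move=> pc R b' ->.
  + by move=> pc R b' r' a' -> h' [<- <-] IH; apply: IH.
  + by move=> pc R b' r' k ->.
  + by move=> pc R b' r' k a' v ->.
- move=> pc R b r k h Rr _ IH b' h'; case: h' h Rr IH => {pc R b'}.
  + by move=> pc R b' ->.
  + by move=> pc R b' r' a' ->.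
  + by move=> pc R b' r' k' -> R' h' [<- <-] _ IH; apply: IH.
  + by move=> pc R b' r' k' a' v -> R' h' [<- <-]; rewrite R'.
- move=> pc R b r k a v h Rr _ IH b' h'; case: h' h Rr IH => {pc R b'}.
  + by move=> pc R b' ->.
  + by move=> pc R b' r' a' ->.
  + by move=> pc R b' r' k' -> R' h' [<- <-]; rewrite R'.
  + move=> pc R b' r' k' a' v' -> R' h' [<- <-]; rewrite R' => -[<- <-] IH.
    exact: IH.
Qed.

(** * Program fragments *)

Definition code_at (P : program A) (pc : nat) (c : program A) : Prop :=
  exists pre post, P = pre ++ c ++ post /\ size pre = pc.

Lemma code_at_cat P pc c1 c2 : code_at P pc (c1 ++ c2) ->
  code_at P pc c1 /\ code_at P (pc + size c1) c2.
Proof.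
move=> [pre [post [-> <-]]]; split.
  by exists pre, (c2 ++ post); rewrite -catA.
by exists (pre ++ c1), post; rewrite size_cat -!catA.
Qed.

Lemma code_at_onth P pc c n : code_at P pc c -> n < size c -> onth P (pc + n) = onth c n.
Proof.
move=> [pre [post [-> <-]]] hn.
by rewrite !onth_cat ltnNge leq_addr /= addKn hn.
Qed.

Lemma code_at_head P pc i c : code_at P pc (i :: c) -> onth P pc = Some i.
Proof. by move=> h; rewrite -[pc]addn0 (code_at_onth h). Qed.

(** A fragment receives its address because jumps are absolute. Pulling answers back from its end to
    its start makes the property compose. *)
Definition frag_ok (f : nat -> program A) (R R' : registers A) : Prop :=
  forall P pc b, code_at P pc (f pc) ->
    returns P (pc + size (f pc)) R' b -> returns P pc R b.

Fixpoint frag_seq (l : seq (nat -> program A)) (pc : nat) : program A :=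
  if l is f :: l' then f pc ++ frag_seq l' (pc + size (f pc)) else [::].

Lemma frag_seq_nil R : frag_ok (frag_seq [::]) R R.
Proof. by move=> P pc b _; rewrite addn0. Qed.

Lemma frag_seq_cons f l R R' R'' :
  frag_ok f R R' -> frag_ok (frag_seq l) R' R'' -> frag_ok (frag_seq (f :: l)) R R''.
Proof.
move=> hf hl P pc b /= /code_at_cat [cf cl]; rewrite size_cat addnA => h.
by apply: hf cf _; apply: hl cl h.
Qed.

Definition emit (r : nat) (u : seq A) : nat -> program A :=
  fun=> [seq Push r a | a <- rev u].

Lemma emit_ok r u R : frag_ok (emit r u) R (set_reg R r (u ++ R r)).
Proof.
rewrite /emit; elim/last_ind: u R => [|u a IH] R P pc b.
  rewrite addn0 => _; have -> // : set_reg R r ([::] ++ R r) = R.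
  by apply: funext => i; rewrite /set_reg; case: eqP => [->|].
rewrite rev_rcons /= => c h; apply: (returns_push (code_at_head c)).
have [_ c'] := @code_at_cat _ _ [:: Push r a] _ c; rewrite addn1 in c'.
apply: (IH _ P pc.+1 b c'); rewrite addSnnS; move: h; congr returns.
by apply: funext => i; rewrite /set_reg eqxx; case: eqP => // _; rewrite cat_rcons.
Qed.

Section Transfer.

Variables (src dst out spare : nat) (h : A -> seq A).

(** Popping the empty register [spare] is an unconditional jump to the head of the loop. *)
Definition transfer_block (pc : nat) (a : A) : program A :=
  Push dst a :: rcons (emit out (h a) 0) (Pop spare (fun=> pc)).

Definition transfer_offset (pc : nat) (l : seq A) : nat :=
  size (flatten [seq transfer_block pc a | a <- l]).

(** The blocks vary in length with [h a], so a target is found by adding the lengths of the blocks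
    before it; all of them together give the exit. *)
Definition transfer (pc : nat) : program A :=
  Pop src (fun o => (pc.+1 + transfer_offset pc
    (if o is Some a then take (index a (enum A)) (enum A) else enum A))%N)
  :: flatten [seq transfer_block pc a | a <- enum A].

Lemma transfer_offset_cons pc a l : transfer_offset pc (a :: l) =
  (size (transfer_block pc a) + transfer_offset pc l)%N.
Proof. by rewrite /transfer_offset -size_cat. Qed.

Lemma code_at_block P pc pc0 l a : a \in l ->
  code_at P pc (flatten [seq transfer_block pc0 a | a <- l]) ->
  code_at P (pc + transfer_offset pc0 (take (index a l) l)) (transfer_block pc0 a).
Proof.
elim: l pc => // x l IH pc al c.
have [cx cl] := @code_at_cat _ _ (transfer_block pc0 x) _ c; rewrite [index _ _]/=.
have [<-|xa] := eqVneq x a; first by rewrite addn0.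
rewrite [take _ _]/= transfer_offset_cons addnA.
by apply: IH cl; move: al; rewrite inE eq_sym (negbTE xa).
Qed.

Hypotheses (src_dst : src != dst) (src_out : src != out) (dst_out : dst != out)
  (spare_src : spare != src) (spare_dst : spare != dst) (spare_out : spare != out).

Definition transferred (R : registers A) : registers A :=
  fun i => if i == src then [::] else if i == dst then rev (R src) ++ R dst
           else if i == out then flatten (map h (rev (R src))) ++ R out else R i.

Lemma transfer_ok R : R spare = [::] -> frag_ok transfer R (transferred R).
Proof.
move=> R0 P pc b c ret; have hd := code_at_head c.
have [_ cb] := @code_at_cat _ _ [:: _] _ c; rewrite addn1 in cb.
have [v Rsrc] : exists v, R src = v by eexists.
elim: v R Rsrc R0 ret => [|a v IH] R Rsrc R0 ret.
  apply: (returns_pop_empty hd Rsrc); move: ret.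
  rewrite /transfer /= -addSnnS -/(transfer_offset _ _).
  congr returns; apply: funext => i; rewrite /transferred Rsrc /=.
  by case: eqP => [->//|_]; case: eqP => [->//|_]; case: eqP => [->|].
apply: (returns_pop hd Rsrc).
have := code_at_block (mem_enum A a) cb; set q := (_ + _)%N.
rewrite /transfer_block -cat1s -cats1 => /code_at_cat [c1 /code_at_cat [c2 c3]].
change (returns P q (set_reg R src v) b).
apply: (returns_push (code_at_head c1)).
rewrite addn1 in c2 c3; apply: (emit_ok c2).
set R2 := set_reg _ out _.
have R2E i : R2 i = if i == src then v else if i == dst then a :: R dst
    else if i == out then h a ++ R out else R i.
  move: src_dst src_out dst_out => /eqP ? /eqP ? /eqP ?.
  by rewrite /R2 /set_reg; do !case: eqP => //; congruence.
apply: (returns_pop_empty (code_at_head c3)).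
  by rewrite R2E (negbTE spare_src) (negbTE spare_dst) (negbTE spare_out).
apply: IH; first by rewrite R2E eqxx.
  by rewrite R2E (negbTE spare_src) (negbTE spare_dst) (negbTE spare_out).
move: ret; congr returns; apply: funext => i; rewrite /transferred !R2E !eqxx.
rewrite Rsrc rev_cons map_rcons flatten_rcons cat_rcons -catA.
move: src_dst src_out dst_out => /eqP ? /eqP ? /eqP ?.
by do !case: eqP => //; congruence.
Qed.

End Transfer.

(** Register 2, where the input is assembled, becomes register 0 of the simulated program. The
    answer is negated for the diagonal argument. *)
Definition shift_instr (base : nat) (i : instruction A) : instruction A :=
  match i with
  | Push r a => Push r.+2 a
  | Pop r k => Pop r.+2 (fun o => (base + k o)%N)
  | Halt b => Halt A (~~ b)
  end.

Lemma shift_returns (M : program A) pc R b : returns M pc R b ->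
  forall P base R', code_at P base (map (shift_instr base) M) ->
  (forall i, R' i.+2 = R i) -> returns P (base + pc) R' (~~ b).
Proof.
move=> ret P base R' cP; have at_pc pc' i : onth M pc' = Some i ->
    onth P (base + pc') = Some (shift_instr base i).
  move=> h; have hs : pc' < size M by rewrite -onthTE h.
  by rewrite (code_at_onth cP) ?size_map // onth_map h.
have set_shift R1 R2 r (v : seq A) : (forall i, R1 i.+2 = R2 i) ->
    forall i, set_reg R1 r.+2 v i.+2 = set_reg R2 r v i.
  by move=> h i; rewrite /set_reg !eqSS h.
elim: ret R' => {pc R b} [pc R b h|pc R b r a h _ IH|pc R b r k h Rr _ IH
  |pc R b r k a v h Rr _ IH] R' hR.
- by apply: returns_halt; rewrite (at_pc _ _ h).
- apply: (returns_push (at_pc _ _ h)); rewrite -addnS; apply: IH.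
  by rewrite hR; apply: set_shift.
- by apply: (returns_pop_empty (at_pc _ _ h)); [rewrite hR|apply: IH].
- apply: (returns_pop (at_pc _ _ h)); first by rewrite hR; exact: Rr.
  by apply: IH; apply: set_shift.
Qed.

Definition three_registers (x y z : seq A) : registers A :=
  fun i => match i with 0 => x | 1 => y | 2 => z | _ => [::] end.

Lemma three_registers_emit u x y z :
  frag_ok (emit 2 u) (three_registers x y z) (three_registers x y (u ++ z)).
Proof.
have -> : three_registers x y (u ++ z) =
    set_reg (three_registers x y z) 2 (u ++ three_registers x y z 2).
  by apply: funext => -[|[|[|i]]].
exact: emit_ok.
Qed.

Lemma three_registers_01 h x y z :
  frag_ok (transfer 0 1 2 3 h) (three_registers x y z)
    (three_registers [::] (rev x ++ y) (flatten (map h (rev x)) ++ z)).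
Proof.
have -> : three_registers [::] (rev x ++ y) (flatten (map h (rev x)) ++ z) =
    transferred 0 1 2 h (three_registers x y z).
  by apply: funext => -[|[|[|i]]].
exact: transfer_ok.
Qed.

Lemma three_registers_10 h x y z :
  frag_ok (transfer 1 0 2 3 h) (three_registers x y z)
    (three_registers (rev y ++ x) [::] (flatten (map h (rev y)) ++ z)).
Proof.
have -> : three_registers (rev y ++ x) [::] (flatten (map h (rev y)) ++ z) =
    transferred 1 0 2 h (three_registers x y z).
  by apply: funext => -[|[|[|i]]].
exact: transfer_ok.
Qed.

(** * Computing the rest of the encoding from its beginning *)

Section Prepare.

Variables (h1 h2 : A -> seq A) (c0 c1 c2 c3 c4 : seq A).

Definition appendix (w : seq A) : seq A :=
  c0 ++ flatten (map h2 w) ++ c1 ++ flatten (map h1 (rev w)) ++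
  c2 ++ flatten (map h2 w) ++ c3 ++ flatten (map h1 (rev w)) ++ c4.

Definition prepared (w : seq A) : seq A := w ++ appendix w.

(** Register 2 is written from its end. Each passage between registers 0 and 1 reverses the word, so
    [h1] is applied along [rev w] and [h2] along [w]. The last two passages put a copy of [w] in
    front. *)
Definition prepare_frags : seq (nat -> program A) :=
  [:: emit 2 c4; transfer 0 1 2 3 h1; emit 2 c3; transfer 1 0 2 3 h2;
      emit 2 c2; transfer 0 1 2 3 h1; emit 2 c1; transfer 1 0 2 3 h2;
      emit 2 c0; transfer 0 1 2 3 (fun=> [::]); transfer 1 0 2 3 (fun a => [:: a])].

Lemma prepare_ok w : frag_ok (frag_seq prepare_frags)
  (three_registers w [::] [::]) (three_registers w [::] (prepared w)).
Proof.
have one v : flatten [seq [:: a] | a <- v] = v :> seq A by elim: v => //= a v ->.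
rewrite /prepare_frags.
have none v : flatten [seq [::] | a <- v] = [::] :> seq A by elim: v.
refine (@frag_seq_cons _ _ _ _ _ (@three_registers_emit _ _ _ _) _).
refine (@frag_seq_cons _ _ _ _ _ (@three_registers_01 _ _ _ _) _); rewrite !cats0.
refine (@frag_seq_cons _ _ _ _ _ (@three_registers_emit _ _ _ _) _).
refine (@frag_seq_cons _ _ _ _ _ (@three_registers_10 _ _ _ _) _); rewrite revK cats0.
refine (@frag_seq_cons _ _ _ _ _ (@three_registers_emit _ _ _ _) _).
refine (@frag_seq_cons _ _ _ _ _ (@three_registers_01 _ _ _ _) _); rewrite cats0.
refine (@frag_seq_cons _ _ _ _ _ (@three_registers_emit _ _ _ _) _).
refine (@frag_seq_cons _ _ _ _ _ (@three_registers_10 _ _ _ _) _); rewrite revK cats0.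
refine (@frag_seq_cons _ _ _ _ _ (@three_registers_emit _ _ _ _) _).
refine (@frag_seq_cons _ _ _ _ _ (@three_registers_01 _ _ _ _) _); rewrite none cats0.
refine (@frag_seq_cons _ _ _ _ _ (@three_registers_10 _ _ _ _) _); rewrite one revK cats0.
by rewrite /prepared /appendix; apply: frag_seq_nil.
Qed.

Definition diagonal (M : program A) : program A :=
  let pre := frag_seq prepare_frags 0 in pre ++ map (shift_instr (size pre)) M.

Lemma diagonal_returns M w b : returns M 0 (initial_registers (prepared w)) b ->
  returns (diagonal M) 0 (initial_registers w) (~~ b).
Proof.
move=> ret; have -> : initial_registers w = three_registers w [::] [::].
  by apply: funext => -[|[|[|i]]].
apply: prepare_ok.
  by exists [::], (map (shift_instr (size (frag_seq prepare_frags 0))) M).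
rewrite add0n -[size _]addn0; apply: (shift_returns ret).
  by exists (frag_seq prepare_frags 0), [::]; rewrite cats0.
by case.
Qed.

End Prepare.

End Programs.

(** * The instance attached to a program and an input *)

Notation letters5 := (option (braid_letter 5)).

Definition instance_words (D : program letters5) (w : seq letters5) :
    seq (braid_word 5) :=
  all_words (program_gens D) (program_rels D) (goal_word w).

Lemma instance_sound D w :
  identity_problem (instance_words D w) -> returns D 0 (initial_registers w) true.
Proof.
move=> hid; apply: contrapT => nret.
have nacc : ~ accepts D 0 (start_counters w).
  move=> acc; apply: nret; apply: (accepts_returns acc).
  apply: funext => -[|i]; rewrite /start_counters /upd //=.
exact: (@identity_not_above _ (program_gens D) _ _ (program_model nacc)) hid.
Qed.

Lemma instance_complete D w : returns D 0 (initial_registers w) true ->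
  identity_problem (instance_words D w) /\ group_problem (instance_words D w).
Proof.
move=> ret; apply: identity_of_rel_eq.
- move=> z hz; apply/allP => x xz; rewrite /program_gens mem_cat; apply/orP; right.
  rewrite mem_cat; apply/orP; right; apply: map_f; apply/flattenP; by exists z.
- have ld (a : letters5) : load a \in program_gens D.
    rewrite /program_gens mem_cat; apply/orP; right; rewrite mem_cat; apply/orP; left.
    by apply: map_f; rewrite mem_enum.
  pose q (x : gen * bool) := x.1 \in program_gens D; change (all q (goal_word w)).
  have l1 : all q (loads w) by apply/allP => x /mapP[a _ ->]; apply: ld.
  have l2 : all q (unloads w) by apply/allP => x /mapP[a _ ->]; apply: ld.
  have k0 b : q (Kap, b) by apply: mem_head.
  have p0 b : q (Pt 0, b) by rewrite /q inE mem_head orbT.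
  move: q l1 l2 k0 p0 => q l1 l2 k0 p0.
  rewrite /goal_word /= all_cat /= all_cat /= all_cat /=.
  by rewrite l1 l2 !k0 !p0.
(* The end marker makes the alphabet nonempty, so the base is at least 2. *)
- by apply: returns_rel_eq ret; apply/card_gt0P; exists None.
Qed.

(** * The diagonal argument *)

Lemma flatten_goal_word (A : finType) (T : Type) (L : option (pletter gen) -> seq T)
    (w : seq A) :
  flatten (map L (rcons (map some (None :: map some (goal_word w))) None)) =
  (L (Some None) ++ L (Some (Some (Kap, false)))) ++
  flatten (map (fun a => L (Some (Some (load a, false)))) w) ++
  L (Some (Some (Pt 0, false))) ++
  flatten (map (fun a => L (Some (Some (load a, true)))) (rev w)) ++
  L (Some (Some (Kap, true))) ++
  flatten (map (fun a => L (Some (Some (load a, false)))) w) ++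
  L (Some (Some (Pt 0, true))) ++
  flatten (map (fun a => L (Some (Some (load a, true)))) (rev w)) ++ L None.
Proof.
have ld b v : flatten (map L (map some (map some [seq (load a, b) | a <- v]))) =
    flatten (map (fun a => L (Some (Some (load a, b)))) v).
  by elim: v => //= a v ->.
rewrite map_rcons flatten_rcons /goal_word /unloads /loads.
rewrite !(map_cons, map_cat) /= !flatten_cat /= !flatten_cat /= !flatten_cat /=.
by rewrite !ld -!catA.
Qed.

Definition letter_word (c : option (pletter gen)) : seq letters5 :=
  map some (left_letter (code_letter (c, true))).

Definition load_letter (b : bool) (a : letters5) : seq letters5 :=
  letter_word (Some (Some (load a, b))).

(* The encoding of [token_word (Top (goal_word w))] is computed by substitution
   from [w] and its reversal. *)
Definition goal_encoding (w : seq letters5) : seq letters5 :=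
  appendix (load_letter true) (load_letter false)
    (letter_word (Some None) ++ letter_word (Some (Some (Kap, false))))
    (letter_word (Some (Some (Pt 0, false)))) (letter_word (Some (Some (Kap, true))))
    (letter_word (Some (Some (Pt 0, true)))) (rcons (letter_word None) None) w.

Lemma encode_token (v : seq (gen * bool)) : map some (token_word (Top v)) =
  flatten (map letter_word (rcons (map some (None :: map some v)) None)).
Proof.
rewrite /token_word cats0 /left_word /first_word /pos_word.
move: (None :: map some v) => u; rewrite !map_rcons !flatten_rcons map_cat.
congr (_ ++ _); elim: u => [|c u IH] //.
by rewrite !map_cons [flatten (_ :: _)]/= map_cat IH.
Qed.

Lemma encode_words_rcons n (L : seq (braid_word n)) u :
  encode_words (rcons L u) = encode_words L ++ rcons (map some u) None.
Proof. by rewrite /encode_words map_rcons flatten_rcons. Qed.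

Lemma encode_instance D w : encode_words (instance_words D w) =
  encode_words (fixed_words (program_gens D) (program_rels D)) ++ goal_encoding w.
Proof.
rewrite encode_words_rcons encode_token flatten_goal_word.
rewrite /goal_encoding /appendix /load_letter.
move: (encode_words _) letter_word => u L.
by rewrite -!cats1 -!catA.
Qed.

(* Diagonalization: a program deciding [Q] yields a program [D] which on input
   [w] answers the negation of [Q] for the instance whose encoding is [w]
   followed by [goal_encoding w]; feed it its own fixed words. *)
Lemma undecidable_of_instances (Q : seq (braid_word 5) -> Prop) :
  (forall D w, returns D 0 (initial_registers w) true -> Q (instance_words D w)) ->
  (forall D w, Q (instance_words D w) -> returns D 0 (initial_registers w) true) ->
  undecidable (@encode_words 5) Q.
Proof.
move=> complete sound [M decM].
pose D := diagonal (load_letter true) (load_letter false)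
    (letter_word (Some None) ++ letter_word (Some (Some (Kap, false))))
    (letter_word (Some (Some (Pt 0, false)))) (letter_word (Some (Some (Kap, true))))
    (letter_word (Some (Some (Pt 0, true)))) (rcons (letter_word None) None) M.
(* There is no circularity: [D] depends only on [M], and the fixed words only on [D]. *)
pose w := encode_words (fixed_words (program_gens D) (program_rels D)).
have [b] := decM (instance_words D w).
rewrite encode_instance -/w => /diagonal_returns; rewrite -/D => ret bQ.
(* If [M] answers true, [Q] makes [D] return true although it returns false. If [M] answers false,
   [D] returns true, so [Q] holds against the answer. *)
case: b ret bQ => ret [bQ Qb].
  by have := returns_det ret (sound _ _ (bQ isT)).
by have := Qb (complete _ _ ret).
Qed.

Theorem theorem3 :
  undecidable (@encode_words 5) (@identity_problem 5) /\
  undecidable (@encode_words 5) (@group_problem 5).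
Proof.
split; apply: undecidable_of_instances => D w.
- by case/instance_complete.
- exact: instance_sound.
- by case/instance_complete.
- by move/identity_of_group/instance_sound.
Qed.
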